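(* For all complex numbers $z$ and $\alpha$ with $\operatorname{Re}(z)>0$ and $\operatorname{Re}(\alpha)>-\operatorname{Re}(z)$, Binet's function $\mu(z)$ has the convergent factorial expansion $$\mu(z)=\sum_{m=1}^{\infty}\frac{b_m(\alpha)}{\prod_{k=0}^{m-1}(z+\alpha+k)},$$ where for each integer $m\ge 1$ the Binet polynomial $b_m(\alpha)$ is $$b_m(\alpha)=\frac1m\sum_{k=1}^{m}\left\{\frac{\alpha^{k+2}-(\alpha-1)^{k+2}}{k+2}+\frac{\left(\frac12-\alpha\right)\left(\alpha^{k+1}-(\alpha-1)^{k+1}\right)}{k+1}\right\}(-1)^{k-m}S_m^{(k)} .$$ Moreover, for every $m\ge1$, with $c_k=b_k(0)$, $$b_m(\alpha)=c_m+\alpha\sum_{k=1}^{m-1}\binom{m-1}{k-1}\left(\prod_{j=1}^{m-k-1}(\alpha+j)\right)c_k ,$$ and $$b_m(\alpha)=\frac1m\int_{\alpha-1}^{\alpha}\left(x+\tfrac12-\alpha\right)\prod_{k=0}^{m-1}(k+x)\,dx .$$ In particular $b_1(\alpha)=\frac1{12}$ and $b_2(\alpha)=\frac{\alpha}{12}$.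
   Context: Binet's function is $\mu(z)=\log\Gamma(z)-\left(z-\frac12\right)\log z+z-\frac12\log(2\pi)$ for $\operatorname{Re}(z)>0$ (principal branches, so that $\mu$ is analytic there and real for real $z>0$). $S_m^{(k)}$ denotes the (signed) Stirling number of the first kind, defined by $\prod_{k=0}^{m-1}(x-k)=\sum_{k=0}^{m}S_m^{(k)}x^k$. The numbers $c_k=b_k(0)$ are given by $c_m=\frac{(-1)^{m-1}}{2m}\sum_{k=1}^{m}\frac{k\,S_m^{(k)}}{(k+2)(k+1)}$. Empty products equal $1$ and empty sums equal $0$. For complex $\alpha$ the integral is along the segment from $\alpha-1$ to $\alpha$. *)

(* Defs.v *)
(* Stdlib reals and Coquelicot. *)
From Stdlib Require Import Reals ZArith Lia Lra.
From Coquelicot Require Import Coquelicot.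

Open Scope R_scope.

Definition Cexp (z : C) : C := (exp (Re z) * cos (Im z), exp (Re z) * sin (Im z)).

(* Principal logarithm on the open half-plane 0 < Re z, the only place where it
   is used: there the principal argument is [atan (Im z / Re z)]. *)
Definition Clog (z : C) : C := (ln (Cmod z), atan (Im z / Re z)).

(* Euler's integral, for 0 < Re z; here t ^ (z - 1) = exp ((z - 1) ln t). *)
Definition CGamma (z : C) : C :=
  RInt_gen (V := C_R_CompleteNormedModule)
    (fun t : R => (Cexp ((z - 1) * RtoC (ln t)) * RtoC (exp (- t)))%C)
    (at_right 0) (Rbar_locally p_infty).

(* [logGamma] is the branch of log Gamma that is analytic on the half-plane
   0 < Re z and real on the positive half-line.  These conditions determine
   [logGamma] on the half-plane; its values elsewhere are irrelevant. *)
Definition is_logGamma (logGamma : C -> C) : Prop :=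
  (forall z : C, 0 < Re z ->
     ex_derive (K := C_AbsRing) (V := C_NormedModule) logGamma z) /\
  (forall z : C, 0 < Re z -> Cexp (logGamma z) = CGamma z) /\
  (forall x : R, 0 < x -> Im (logGamma (RtoC x)) = 0).

Definition Binet (logGamma : C -> C) (z : C) : C :=
  (logGamma z - (z - 1 / 2) * Clog z + z - 1 / 2 * RtoC (ln (2 * PI)))%C.

(* [Csum a m n] is the sum of [a k] for m <= k <= n, zero if n < m. *)
Definition Csum (a : nat -> C) (m n : nat) : C :=
  sum_n_m (G := C_AbelianMonoid) a m n.

(* [Cprod a n] is the product of [a k] for k < n. *)
Fixpoint Cprod (a : nat -> C) (n : nat) : C :=
  match n with
  | O => 1%C
  | S p => (Cprod a p * a p)%C
  end.

(* Coefficient of x ^ k in x (x - 1) ... (x - (m - 1)), obtained by expanding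
   the multiplication by the last factor; see [stirling1_spec]. *)
Fixpoint stirling1 (m k : nat) : Z :=
  match m, k with
  | O, O => 1
  | O, S _ => 0
  | S p, O => - Z.of_nat p * stirling1 p 0
  | S p, S q => stirling1 p q - Z.of_nat p * stirling1 p (S q)
  end%Z.

Lemma stirling1_gt (m k : nat) : (m < k)%nat -> stirling1 m k = 0%Z.
Proof.
revert k; induction m as [|m IH]; intros [|k] H; try lia; simpl; auto.
rewrite !IH by lia; lia.
Qed.

Lemma stirling1_spec (m : nat) (x : C) :
  Cprod (fun k => x - RtoC (INR k))%C m =
  Csum (fun k => RtoC (IZR (stirling1 m k)) * x ^ k)%C 0 m.
Proof.
induction m as [|m IH].
  unfold Csum; rewrite sum_n_n; simpl; ring.
set (a := fun k => (RtoC (IZR (stirling1 m k)) * x ^ k)%C) in IH.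
assert (E : Csum a 0 m = (a O + Csum (fun k => a (S k)) 0 m)%C).
{ unfold Csum; rewrite sum_n_m_S.
  transitivity (sum_n_m (G := C_AbelianMonoid) a 0 (S m)).
    rewrite sum_n_Sm by lia.
    unfold a at 3; rewrite stirling1_gt by lia.
    change (@plus C_AbelianMonoid) with Cplus; cbv beta.
    set (t := sum_n_m a 0 m : C); change (t = t + 0 * x ^ S m)%C; ring.
  rewrite sum_Sn_m by lia; reflexivity. }
assert (F : Csum (fun k => RtoC (IZR (stirling1 (S m) k)) * x ^ k)%C 0 (S m) =
  (- RtoC (INR m) * a O + (x * Csum a 0 m +
     - RtoC (INR m) * Csum (fun k => a (S k)) 0 m))%C).
{ unfold Csum; rewrite sum_Sn_m by lia; rewrite <- sum_n_m_S.
  change (@plus C_AbelianMonoid) with Cplus.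
  apply (f_equal2 Cplus).
    unfold a; simpl stirling1.
    rewrite mult_IZR, opp_IZR, <- INR_IZR_INZ, RtoC_mult, RtoC_opp.
    match goal with |- @eq _ ?u ?v => change (@eq C u v) end; ring.
  change Cplus with (@plus C_AbelianMonoid); change Cmult with (@mult C_Ring) at 1 2.
  rewrite <- (sum_n_m_mult_l (K := C_Ring) x).
  rewrite <- (sum_n_m_mult_l (K := C_Ring) (- RtoC (INR m))%C).
  rewrite <- sum_n_m_plus.
  apply sum_n_m_ext; intros k; unfold a; simpl stirling1.
  rewrite minus_IZR, mult_IZR, <- INR_IZR_INZ, RtoC_minus, RtoC_mult.
  change (@plus C_AbelianMonoid) with Cplus; change (@mult C_Ring) with Cmult.
  rewrite Cpow_S; match goal with |- @eq _ ?u ?v => change (@eq C u v) end; ring. }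
rewrite F; simpl Cprod; rewrite IH, E; ring.
Qed.

Definition binet_poly (m : nat) (alpha : C) : C :=
  (1 / RtoC (INR m) *
   Csum (fun k =>
     ((alpha ^ (k + 2) - (alpha - 1) ^ (k + 2)) / RtoC (INR (k + 2)) +
      (1 / 2 - alpha) * (alpha ^ (k + 1) - (alpha - 1) ^ (k + 1))
        / RtoC (INR (k + 1))) *
     RtoC (powerRZ (- 1) (Z.of_nat k - Z.of_nat m)) *
     RtoC (IZR (stirling1 m k))) 1 m)%C.

Definition binet_num (m : nat) : C := binet_poly m 0%C.

Lemma binet_num_explicit (m : nat) : (1 <= m)%nat ->
  binet_num m =
  (RtoC ((- 1) ^ (m - 1)) / (2 * RtoC (INR m)) *
   Csum (fun k =>
     RtoC (INR k) * RtoC (IZR (stirling1 m k)) /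
     (RtoC (INR (k + 2)) * RtoC (INR (k + 1)))) 1 m)%C.
Proof.
intros Hm; unfold binet_num, binet_poly.
assert (L : forall c a n p, (c * Csum a n p = Csum (fun k => c * a k) n p)%C)
  by (intros; symmetry; apply (sum_n_m_mult_l (K := C_Ring))).
rewrite !L; apply sum_n_m_ext_loc; intros k Hk.
match goal with |- @eq _ ?u ?v => change (@eq C u v) end.
assert (HS : forall n, (RtoC (INR (S n)) <> 0)%C).
{ intros n H; apply RtoC_inj in H; now apply (not_0_INR (S n)). }
assert (P : powerRZ (- 1) (Z.of_nat k - Z.of_nat m) = (- 1) ^ k * (- 1) ^ m).
{ unfold Zminus; rewrite powerRZ_add by lra.
  rewrite powerRZ_neg'; rewrite <- !pow_powerRZ, <- pow_inv.
  replace (/ -1) with (-1) by field; reflexivity. }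
assert (Q : (- 1) ^ k * (- 1) ^ k = 1).
{ rewrite <- Rpow_mult_distr; replace (-1 * -1) with 1 by ring; apply pow1. }
assert (Z0 : ((0 - 1) ^ k = RtoC ((- 1) ^ k))%C).
{ rewrite RtoC_pow; f_equal; unfold Cminus; rewrite Cplus_0_l, <- RtoC_opp; reflexivity. }
rewrite P, !Cpow_add_r, Z0.
destruct m as [|m]; [lia|].
replace (S m - 1)%nat with m by lia.
rewrite RtoC_mult.
replace (RtoC ((-1) ^ S m)) with (- RtoC ((-1) ^ m))%C
  by (simpl pow; rewrite RtoC_mult; ring).
assert (Q' : (RtoC ((-1) ^ k) * RtoC ((-1) ^ k) = 1)%C)
  by (rewrite <- RtoC_mult, Q; reflexivity).
replace (k + 2)%nat with (S (S k)) by lia.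
replace (k + 1)%nat with (S k) by lia.
assert (H1 := HS (S k)); assert (H2 := HS k); assert (H3 := HS m).
rewrite !S_INR, !RtoC_plus in *.
set (e := RtoC ((-1) ^ k)) in *; set (s := RtoC (IZR (stirling1 _ _))).
set (f := RtoC ((-1) ^ m)); set (c := RtoC (INR k)) in *.
set (d := RtoC (INR m)) in *.
assert (T : RtoC 2 <> RtoC 0) by (intros H; apply RtoC_inj in H; lra).
simpl Cpow.
transitivity (e * e * (f * (c * s) / (2 * (d + 1) * ((c + 1 + 1) * (c + 1)))))%C.
  field; repeat split; assumption.
rewrite Q'; field; repeat split; assumption.
Qed.

(* Integral of f along the segment from a to b. *)
Definition Csegment_int (f : C -> C) (a b : C) : C :=
  ((b - a) *
   RInt (V := C_R_CompleteNormedModule)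
     (fun t : R => f (a + RtoC t * (b - a))) 0 1)%C.

(* Main.v *)
Require Import Defs.
From Stdlib Require Import Reals ZArith Lra Lia List.
From Coquelicot Require Import Coquelicot.
Open Scope R_scope.

(** With [w = z + alpha] and [u_m(t) = (alpha - 1 + t)_m / (w)_m] (rising factorials), the
    integral form of [b_m] turns [b_m / (w)_m] into the integral over [[0, 1]] of
    [(t - 1/2) u_m(t) / m].  Replacing [z] by [z + 1] in the series and telescoping in [m],
    its sum [F] satisfies [F(z) - F(z + 1) = g(z)] with
    [g(z) = (z + 1/2) (log (z + 1) - log z) - 1]; since [F(z + N)] tends to [0], [F] is
    Gudermann's series [g(z) + g(z + 1) + ...], whatever [alpha] is.

    Put [S(z) = F(z) + (z - 1/2) log z - z + log(2 pi)/2], so that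
    [S(z + 1) = S(z) + log z], and Wallis' product gives [S(1) = 0].  Euler's integral at
    [z + N + 1] is asymptotic to [N^z N!], because the Gamma density of order [N]
    concentrates near [N]; dividing by [(z)_(N+1)] gives Gamma = exp S.  A logarithm of
    Gamma that is continuous on vertical lines and real on the real axis is then [S]. *)

(** * Complex-valued functions of a real variable *)

Definition Ccont (f : R -> C) (t : R) : Prop :=
  continuous (fun s => Re (f s)) t /\ continuous (fun s => Im (f s)) t.

Definition Cderiv (f : R -> C) (t : R) (l : C) : Prop :=
  is_derive (fun s => Re (f s)) t (Re l) /\ is_derive (fun s => Im (f s)) t (Im l).

Lemma C_eq (u v : C) : Re u = Re v -> Im u = Im v -> u = v.
Proof. destruct u, v; simpl; congruence. Qed.

Lemma Re_pos_neq_0 (z : C) : 0 < Re z -> z <> 0%C.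
Proof. intros H E; rewrite E in H; simpl in H; lra. Qed.

Lemma Cmod_sqr (z : C) : Cmod z * Cmod z = Re z * Re z + Im z * Im z.
Proof. generalize (Cmod2_alt z); simpl; rewrite !Rmult_1_r; auto. Qed.

Lemma Re_le_Cmod (z : C) : Re z <= Cmod z.
Proof. eapply Rle_trans; [apply Rle_abs | apply re_le_Cmod]. Qed.

Lemma Im_le_Cmod (z : C) : Rabs (Im z) <= Cmod z.
Proof. eapply Rle_trans; [apply Rmax_r | apply (Rmax_Cmod z)]. Qed.

Lemma Ccont_const (c : C) t : Ccont (fun _ => c) t.
Proof. split; apply continuous_const. Qed.

Lemma Ccont_plus (f g : R -> C) t : Ccont f t -> Ccont g t -> Ccont (fun s => (f s + g s)%C) t.
Proof.
intros [a b] [c d]; split.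
- apply (continuous_plus (fun s => Re (f s)) (fun s => Re (g s))); auto.
- apply (continuous_plus (fun s => Im (f s)) (fun s => Im (g s))); auto.
Qed.

Lemma Ccont_mult (f g : R -> C) t : Ccont f t -> Ccont g t -> Ccont (fun s => (f s * g s)%C) t.
Proof.
intros [a b] [c d]; split.
- apply (continuous_minus (fun s => Re (f s) * Re (g s)) (fun s => Im (f s) * Im (g s)));
    apply (continuous_mult (K := R_AbsRing)); auto.
- apply (continuous_plus (fun s => Re (f s) * Im (g s)) (fun s => Im (f s) * Re (g s)));
    apply (continuous_mult (K := R_AbsRing)); auto.
Qed.

Lemma Ccont_opp (f : R -> C) t : Ccont f t -> Ccont (fun s => (- f s)%C) t.
Proof.
intros [a b]; split.
- apply (continuous_opp (fun s => Re (f s))); auto.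
- apply (continuous_opp (fun s => Im (f s))); auto.
Qed.

Lemma Ccont_minus (f g : R -> C) t : Ccont f t -> Ccont g t -> Ccont (fun s => (f s - g s)%C) t.
Proof. intros a b; apply Ccont_plus; auto; apply Ccont_opp; auto. Qed.

Lemma Ccont_inv (f : R -> C) t : f t <> 0%C -> Ccont f t -> Ccont (fun s => (/ f s)%C) t.
Proof.
intros N [a b].
assert (P : Re (f t) ^ 2 + Im (f t) ^ 2 <> 0).
{ rewrite <- Cmod2_alt; apply pow_nonzero; generalize (proj1 (Cmod_gt_0 _) N); lra. }
assert (Q : continuous (fun s => / (Re (f s) ^ 2 + Im (f s) ^ 2)) t).
{ apply continuous_Rinv_comp; auto; simpl.
  apply (continuous_plus (fun s => Re (f s) * (Re (f s) * 1)) (fun s => Im (f s) * (Im (f s) * 1)));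
    [ apply (continuous_mult (K := R_AbsRing) (fun s => Re (f s)) (fun s => Re (f s) * 1)); auto;
      apply (continuous_mult (K := R_AbsRing) (fun s => Re (f s)) (fun s => 1)); auto
    | apply (continuous_mult (K := R_AbsRing) (fun s => Im (f s)) (fun s => Im (f s) * 1)); auto;
      apply (continuous_mult (K := R_AbsRing) (fun s => Im (f s)) (fun s => 1)); auto ];
    apply continuous_const. }
split.
- apply (continuous_mult (K := R_AbsRing) (fun s => Re (f s))); auto.
- apply (continuous_mult (K := R_AbsRing) (fun s => - Im (f s))); auto.
  apply (continuous_opp (fun s => Im (f s))); auto.
Qed.

Lemma Ccont_div (f g : R -> C) t :
  g t <> 0%C -> Ccont f t -> Ccont g t -> Ccont (fun s => (f s / g s)%C) t.
Proof. intros; apply Ccont_mult; auto; apply Ccont_inv; auto. Qed.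

Lemma Cderiv_eq (f : R -> C) t l l' : l = l' -> Cderiv f t l -> Cderiv f t l'.
Proof. intros ->; auto. Qed.

Lemma Cderiv_cont (f : R -> C) t l : Cderiv f t l -> Ccont f t.
Proof.
intros [a b]; split.
- apply (ex_derive_continuous (fun s => Re (f s))); eexists; exact a.
- apply (ex_derive_continuous (fun s => Im (f s))); eexists; exact b.
Qed.

Lemma Cderiv_const (c : C) t : Cderiv (fun _ => c) t 0.
Proof.
split; [exact (is_derive_const (V := R_NormedModule) (Re c) t)
       | exact (is_derive_const (V := R_NormedModule) (Im c) t)].
Qed.

Lemma Cderiv_RtoC (f : R -> R) t d : is_derive f t d -> Cderiv (fun s => RtoC (f s)) t (RtoC d).
Proof. intros H; split; [exact H | exact (is_derive_const (V := R_NormedModule) 0 t)]. Qed.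

Lemma Cderiv_id t : Cderiv (fun s => RtoC s) t 1.
Proof. apply Cderiv_RtoC; exact (is_derive_id (K := R_AbsRing) t). Qed.

Lemma Cderiv_plus (f g : R -> C) t a b :
  Cderiv f t a -> Cderiv g t b -> Cderiv (fun s => (f s + g s)%C) t (a + b).
Proof.
intros [p q] [r s]; split.
- apply (is_derive_plus (fun s => Re (f s)) (fun s => Re (g s))); auto.
- apply (is_derive_plus (fun s => Im (f s)) (fun s => Im (g s))); auto.
Qed.

Lemma Cderiv_opp (f : R -> C) t a : Cderiv f t a -> Cderiv (fun s => (- f s)%C) t (- a).
Proof.
intros [p q]; split.
- apply (is_derive_opp (fun s => Re (f s))); auto.
- apply (is_derive_opp (fun s => Im (f s))); auto.
Qed.

Lemma Cderiv_minus (f g : R -> C) t a b :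
  Cderiv f t a -> Cderiv g t b -> Cderiv (fun s => (f s - g s)%C) t (a - b).
Proof. intros; apply Cderiv_plus; auto; apply Cderiv_opp; auto. Qed.

Lemma Cderiv_mult (f g : R -> C) t a b :
  Cderiv f t a -> Cderiv g t b ->
  Cderiv (fun s => (f s * g s)%C) t (a * g t + f t * b).
Proof.
intros [p q] [r s]; split; simpl.
- evar_last.
  + apply (is_derive_minus (fun s => Re (f s) * Re (g s)) (fun s => Im (f s) * Im (g s)));
    apply (is_derive_mult (K := R_AbsRing)); eauto; intros; apply Rmult_comm.
  + unfold minus, plus, opp, mult; simpl; unfold Re, Im; ring.
- evar_last.
  + apply (is_derive_plus (fun s => Re (f s) * Im (g s)) (fun s => Im (f s) * Re (g s)));
    apply (is_derive_mult (K := R_AbsRing)); eauto; intros; apply Rmult_comm.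
  + unfold minus, plus, opp, mult; simpl; unfold Re, Im; ring.
Qed.

Lemma Cderiv_scal (c : C) (f : R -> C) t a : Cderiv f t a -> Cderiv (fun s => (c * f s)%C) t (c * a).
Proof.
intros H; eapply Cderiv_eq; [|apply Cderiv_mult; [apply Cderiv_const | exact H]]; cbv beta; ring.
Qed.

Lemma Cderiv_pow (f : R -> C) t a n :
  Cderiv f t a -> Cderiv (fun s => (f s ^ S n)%C) t (RtoC (INR (S n)) * f t ^ n * a).
Proof.
intros H; induction n as [|n IH].
- eapply Cderiv_eq; [|apply Cderiv_mult; [exact H | apply Cderiv_const]]; cbv beta; simpl; ring.
- eapply Cderiv_eq; [|exact (Cderiv_mult f (fun s => f s ^ S n)%C t _ _ H IH)]; cbv beta.
  rewrite (S_INR (S n)), RtoC_plus, !Cpow_S; ring.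
Qed.

Lemma Cderiv_Cexp (f : R -> C) t a : Cderiv f t a -> Cderiv (fun s => Cexp (f s)) t (a * Cexp (f t)).
Proof.
intros [p q]; set (u := fun s => Re (f s)) in *; set (v := fun s => Im (f s)) in *.
assert (eu : ex_derive u t) by (exists (Re a); exact p).
assert (ev : ex_derive v t) by (exists (Im a); exact q).
change (is_derive u t (Re a)) in p; change (is_derive v t (Im a)) in q.
apply is_derive_unique in p; apply is_derive_unique in q.
split; unfold Cexp; simpl; fold (u t) (v t).
- change (is_derive (fun s => exp (u s) * cos (v s)) t
    (Re a * (exp (u t) * cos (v t)) - Im a * (exp (u t) * sin (v t)))).
  auto_derive; auto; change (fun x => u x) with u; change (fun x => v x) with v; rewrite p, q; ring.
- change (is_derive (fun s => exp (u s) * sin (v s)) t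
    (Re a * (exp (u t) * sin (v t)) + Im a * (exp (u t) * cos (v t)))).
  auto_derive; auto; change (fun x => u x) with u; change (fun x => v x) with v; rewrite p, q; ring.
Qed.

Lemma ln_Cmod (z : C) : 0 < Re z -> ln (Cmod z) = / 2 * ln (Re z ^ 2 + Im z ^ 2).
Proof.
intros H; assert (P : 0 < Cmod z) by (generalize (Re_le_Cmod z); lra).
rewrite <- Cmod2_alt; simpl; rewrite Rmult_1_r, ln_mult by auto; field.
Qed.

Lemma Cderiv_Clog (f : R -> C) t a :
  0 < Re (f t) -> Cderiv f t a -> Cderiv (fun s => Clog (f s)) t (a / f t).
Proof.
intros H [p q]; set (u := fun s => Re (f s)) in *; set (v := fun s => Im (f s)) in *.
assert (eu : ex_derive u t) by (exists (Re a); exact p).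
assert (ev : ex_derive v t) by (exists (Im a); exact q).
change (is_derive u t (Re a)) in p; change (is_derive v t (Im a)) in q.
apply is_derive_unique in p; apply is_derive_unique in q.
assert (L : locally t (fun s => 0 < u s)).
{ exact (ex_derive_continuous u t eu (fun y => 0 < y) (open_gt 0 (u t) H)). }
assert (U : 0 < u t) by exact H.
assert (P : 0 < u t ^ 2 + v t ^ 2) by (generalize (pow2_ge_0 (v t)); nra).
split.
- apply (is_derive_ext_loc (fun s => / 2 * ln (u s ^ 2 + v s ^ 2))).
    revert L; apply filter_imp; intros s Hs; symmetry; apply (ln_Cmod (f s)); auto.
  auto_derive; [repeat split; auto; simpl in P; nra |].
  change (fun x => u x) with u; change (fun x => v x) with v; rewrite p, q; simpl; change (fst (f t)) with (u t); change (snd (f t)) with (v t).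
  change (fst a) with (Re a); change (snd a) with (Im a); field; nra.
- change (is_derive (fun s => atan (v s / u s)) t (Im (a / f t)%C)).
  auto_derive; [repeat split; auto; lra |].
  change (fun x => u x) with u; change (fun x => v x) with v; rewrite p, q; simpl; change (fst (f t)) with (u t); change (snd (f t)) with (v t).
  change (fst a) with (Re a); change (snd a) with (Im a); unfold Rsqr; field.
  repeat split; nra.
Qed.

Definition CRInt (f : R -> C) (a b : R) : C := RInt (V := C_R_CompleteNormedModule) f a b.
Notation is_CRInt := (is_RInt (V := C_R_NormedModule)).

Lemma is_CRInt_pair (f : R -> C) a b (l : C) :
  is_RInt (fun t => Re (f t)) a b (Re l) -> is_RInt (fun t => Im (f t)) a b (Im l) ->
  is_CRInt f a b l.
Proof.
intros p q; destruct l as [u v].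
exact (is_RInt_fct_extend_pair (U := R_NormedModule) (V := R_NormedModule) f a b u v p q).
Qed.

Lemma is_CRInt_RtoC (f : R -> R) a b v :
  is_RInt f a b v -> is_CRInt (fun t => RtoC (f t)) a b (RtoC v).
Proof.
intros H; apply is_CRInt_pair; [exact H|].
assert (Z := is_RInt_const (V := R_NormedModule) a b 0).
change (is_RInt (fun _ => 0) a b 0).
evar_last; [exact Z | unfold scal; simpl; unfold mult; simpl; ring].
Qed.

Lemma is_CRInt_Re (f : R -> C) a b (l : C) :
  is_CRInt f a b l -> is_RInt (fun t => Re (f t)) a b (Re l).
Proof. exact (is_RInt_fct_extend_fst (U := R_NormedModule) (V := R_NormedModule) f a b l). Qed.

Lemma is_CRInt_Im (f : R -> C) a b (l : C) :
  is_CRInt f a b l -> is_RInt (fun t => Im (f t)) a b (Im l).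
Proof. exact (is_RInt_fct_extend_snd (U := R_NormedModule) (V := R_NormedModule) f a b l). Qed.

Lemma is_CRInt_plus (f g : R -> C) a b (l m : C) :
  is_CRInt f a b l -> is_CRInt g a b m -> is_CRInt (fun t => (f t + g t)%C) a b (l + m)%C.
Proof. apply (is_RInt_plus (V := C_R_NormedModule)). Qed.

Lemma is_CRInt_scal (c : C) (f : R -> C) a b (l : C) :
  is_CRInt f a b l -> is_CRInt (fun t => (c * f t)%C) a b (c * l)%C.
Proof.
intros H; generalize (is_CRInt_Re _ _ _ _ H) (is_CRInt_Im _ _ _ _ H); intros p q.
apply is_CRInt_pair.
- apply (is_RInt_minus (V := R_NormedModule) (fun t => Re c * Re (f t)) (fun t => Im c * Im (f t)));
  apply (is_RInt_scal (V := R_NormedModule)); auto.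
- apply (is_RInt_plus (V := R_NormedModule) (fun t => Re c * Im (f t)) (fun t => Im c * Re (f t)));
  apply (is_RInt_scal (V := R_NormedModule)); auto.
Qed.

Lemma is_CRInt_minus (f g : R -> C) a b (l m : C) :
  is_CRInt f a b l -> is_CRInt g a b m -> is_CRInt (fun t => (f t - g t)%C) a b (l - m)%C.
Proof. apply (is_RInt_minus (V := C_R_NormedModule)). Qed.

Lemma is_CRInt_derive (F f : R -> C) a b :
  (forall t, Rmin a b <= t <= Rmax a b -> Cderiv F t (f t)) ->
  (forall t, Rmin a b <= t <= Rmax a b -> Ccont f t) ->
  is_CRInt f a b (F b - F a)%C.
Proof.
intros D K; apply is_CRInt_pair.
- exact (is_RInt_derive (V := R_CompleteNormedModule) (fun t => Re (F t)) (fun t => Re (f t)) a b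
    (fun t H => proj1 (D t H)) (fun t H => proj1 (K t H))).
- exact (is_RInt_derive (V := R_CompleteNormedModule) (fun t => Im (F t)) (fun t => Im (f t)) a b
    (fun t H => proj2 (D t H)) (fun t H => proj2 (K t H))).
Qed.

Lemma is_CRInt_cont (f : R -> C) a b :
  (forall t, Rmin a b <= t <= Rmax a b -> Ccont f t) -> is_CRInt f a b (CRInt f a b).
Proof.
intros K; apply (RInt_correct (V := C_R_CompleteNormedModule)).
exists (RInt (fun t => Re (f t)) a b, RInt (fun t => Im (f t)) a b).
apply is_CRInt_pair.
- exact (RInt_correct (V := R_CompleteNormedModule) (fun t => Re (f t)) a b
    (ex_RInt_continuous (V := R_CompleteNormedModule) _ _ _ (fun t H => proj1 (K t H)))).
- exact (RInt_correct (V := R_CompleteNormedModule) (fun t => Im (f t)) a b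
    (ex_RInt_continuous (V := R_CompleteNormedModule) _ _ _ (fun t H => proj2 (K t H)))).
Qed.

Lemma CRInt_unique (f : R -> C) a b (l : C) : is_CRInt f a b l -> CRInt f a b = l.
Proof. apply (is_RInt_unique (V := C_R_CompleteNormedModule)). Qed.

Lemma is_CRInt_ext (f g : R -> C) a b (l : C) :
  (forall t, Rmin a b < t < Rmax a b -> f t = g t) -> is_CRInt f a b l -> is_CRInt g a b l.
Proof. apply (is_RInt_ext (V := C_R_NormedModule)). Qed.

Lemma is_CRInt_le (f : R -> C) (g : R -> R) a b (l : C) m :
  a <= b -> (forall t, a <= t <= b -> Cmod (f t) <= g t) ->
  is_CRInt f a b l -> is_RInt g a b m -> Cmod l <= m.
Proof.
intros ab H p q; rewrite Cmod_norm.
apply (norm_RInt_le (V := C_R_NormedModule) f g a b l m); auto.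
intros t Ht; generalize (H t Ht); rewrite Cmod_norm; auto.
Qed.

Lemma is_CRInt01_le (f : R -> C) (l : C) M :
  (forall t, 0 <= t <= 1 -> Cmod (f t) <= M) -> is_CRInt f 0 1 l -> Cmod l <= M.
Proof.
intros H p; apply (is_CRInt_le f (fun _ => M) 0 1 l M); auto; try lra.
evar_last; [apply (is_RInt_const (V := R_NormedModule))|].
unfold scal; simpl; unfold mult; simpl; ring.
Qed.

Lemma is_CRInt_eq (f : R -> C) a b (l l' : C) : l = l' -> is_CRInt f a b l -> is_CRInt f a b l'.
Proof. intros ->; auto. Qed.

(** * Binet polynomials *)

Fixpoint Csumlt (a : nat -> C) (n : nat) : C :=
  match n with
  | O => 0%C
  | S p => (Csumlt a p + a p)%C
  end.

Lemma Csumlt_S a n : Csumlt a (S n) = (Csumlt a n + a n)%C.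
Proof. reflexivity. Qed.

Lemma Csumlt_ext a b n : (forall k, (k < n)%nat -> a k = b k) -> Csumlt a n = Csumlt b n.
Proof.
induction n as [|n IH]; intros H; simpl; auto.
rewrite IH, H; auto; lia.
Qed.

Lemma Csumlt_shift a n : Csumlt a (S n) = (a O + Csumlt (fun k => a (S k)) n)%C.
Proof.
induction n as [|n IH]; [simpl; ring|].
change (Csumlt a (S (S n))) with (Csumlt a (S n) + a (S n))%C; rewrite IH; simpl; ring.
Qed.

Lemma Csumlt_plus a b n : Csumlt (fun k => a k + b k)%C n = (Csumlt a n + Csumlt b n)%C.
Proof. induction n as [|n IH]; simpl; [|rewrite IH]; ring. Qed.

Lemma Csumlt_scal c a n : Csumlt (fun k => c * a k)%C n = (c * Csumlt a n)%C.
Proof. induction n as [|n IH]; simpl; [|rewrite IH]; ring. Qed.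

Lemma Csum0_Csumlt a n : Csum a 0 n = Csumlt a (S n).
Proof.
unfold Csum; induction n as [|n IH].
- rewrite sum_n_n; simpl; ring.
- rewrite sum_n_Sm by lia; rewrite IH; reflexivity.
Qed.

Lemma Csum1_Csumlt a n : Csum a 1 n = Csumlt (fun k => a (S k)) n.
Proof.
unfold Csum; induction n as [|n IH].
- rewrite sum_n_m_zero by lia; reflexivity.
- rewrite sum_n_Sm by lia; rewrite IH; reflexivity.
Qed.

Lemma is_CRInt_Csumlt (f : nat -> R -> C) l a b n :
  (forall k, (k < n)%nat -> is_CRInt (f k) a b (l k)) ->
  is_CRInt (fun t => Csumlt (fun k => f k t) n) a b (Csumlt l n).
Proof.
induction n as [|n IH]; intros H; simpl.
- apply is_CRInt_eq with (scal (b - a) (RtoC 0) : C_R_NormedModule).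
    rewrite scal_R_Cmult; apply Cmult_0_r.
  apply (is_RInt_const (V := C_R_NormedModule)).
- apply is_CRInt_plus; auto.
Qed.

Definition rising (x : C) (m : nat) : C := Cprod (fun k => RtoC (INR k) + x)%C m.

Lemma rising_S x m : rising x (S m) = (rising x m * (RtoC (INR m) + x))%C.
Proof. reflexivity. Qed.

Lemma Cprod_ext a b n : (forall k, (k < n)%nat -> a k = b k) -> Cprod a n = Cprod b n.
Proof.
induction n as [|n IH]; intros H; simpl; auto.
rewrite IH, H; auto; lia.
Qed.

Lemma Cprod_shift a n : Cprod a (S n) = (a O * Cprod (fun k => a (S k)) n)%C.
Proof.
induction n as [|n IH]; [simpl; ring|].
change (Cprod a (S (S n))) with (Cprod a (S n) * a (S n))%C; rewrite IH; simpl; ring.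
Qed.

Lemma rising_stirling1 m x :
  rising x (S m) =
  Csumlt (fun k => RtoC (powerRZ (- 1) (Z.of_nat (S k) - Z.of_nat (S m))) *
    RtoC (IZR (stirling1 (S m) (S k))) * x ^ (S k))%C (S m).
Proof.
assert (O : forall n, RtoC ((- 1) ^ n) = ((- (1)) ^ n)%C).
{ intros n; rewrite RtoC_pow, <- RtoC_opp; reflexivity. }
assert (A : forall n, Cprod (fun k => - x - RtoC (INR k))%C n = (RtoC ((- 1) ^ n) * rising x n)%C).
{ induction n as [|n IH]; [unfold rising; simpl; ring|].
  rewrite rising_S; simpl Cprod; rewrite IH, !O, Cpow_S; ring. }
assert (Q : forall n, (RtoC ((- 1) ^ n) * RtoC ((- 1) ^ n) = 1)%C).
{ intros n; rewrite <- RtoC_mult, <- Rpow_mult_distr.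
  replace (-1 * -1) with 1 by ring; rewrite pow1; reflexivity. }
assert (B : rising x (S m) = (RtoC ((- 1) ^ S m) * Cprod (fun k => - x - RtoC (INR k))%C (S m))%C).
{ rewrite A; generalize (Q (S m)); intros E.
  transitivity ((RtoC ((- 1) ^ S m) * RtoC ((- 1) ^ S m)) * rising x (S m))%C; [rewrite E|]; ring. }
rewrite B, stirling1_spec, Csum0_Csumlt, Csumlt_shift.
assert (Z0 : forall n, stirling1 (S n) 0 = 0%Z).
{ induction n as [|n IH]; [reflexivity|].
  change (stirling1 (S (S n)) 0) with (- Z.of_nat (S n) * stirling1 (S n) 0)%Z.
  rewrite IH; ring. }
rewrite Z0, Cmult_0_l, Cplus_0_l, <- Csumlt_scal.
apply Csumlt_ext; intros k _.
assert (P : powerRZ (- 1) (Z.of_nat (S k) - Z.of_nat (S m)) = (- 1) ^ S k * (- 1) ^ S m).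
{ unfold Zminus; rewrite powerRZ_add by lra.
  rewrite powerRZ_neg'; rewrite <- !pow_powerRZ, <- pow_inv.
  replace (/ -1) with (-1) by field; reflexivity. }
rewrite P, RtoC_mult.
replace ((- x) ^ S k)%C with (RtoC ((- 1) ^ S k) * x ^ S k)%C; [ring|].
rewrite O, <- Cpow_mult_l; f_equal; ring.
Qed.

Lemma RtoC_INR_neq_0 n : RtoC (INR (S n)) <> 0%C.
Proof. intros H; apply RtoC_inj in H; now apply (not_0_INR (S n)). Qed.

Lemma Ccont_id t : Ccont (fun s => RtoC s) t.
Proof. eapply Cderiv_cont; apply Cderiv_id. Qed.

Lemma Ccont_pow (f : R -> C) t n : Ccont f t -> Ccont (fun s => f s ^ n)%C t.
Proof.
intros H; induction n as [|n IH]; [apply Ccont_const|].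
apply (Ccont_mult f (fun s => f s ^ n)%C); auto.
Qed.

Lemma Ccont_rising (f : R -> C) t n : Ccont f t -> Ccont (fun s => rising (f s) n) t.
Proof.
intros H; induction n as [|n IH]; [apply Ccont_const|].
apply (Ccont_mult (fun s => rising (f s) n) (fun s => RtoC (INR n) + f s)%C); auto.
apply Ccont_plus; auto; apply Ccont_const.
Qed.

Lemma Ccont_shift (c : C) t : Ccont (fun s => c + RtoC s)%C t.
Proof. apply Ccont_plus; [apply Ccont_const | apply Ccont_id]. Qed.

Lemma Cderiv_shift (c : C) t : Cderiv (fun s => c + RtoC s)%C t 1.
Proof. eapply Cderiv_eq; [|apply Cderiv_plus; [apply Cderiv_const | apply Cderiv_id]]; ring. Qed.

Lemma is_CRInt_monomial (alpha : C) k :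
  is_CRInt (fun t => (RtoC t - 1 / 2) * (alpha - 1 + RtoC t) ^ k)%C 0 1
   ((alpha ^ (k + 2) - (alpha - 1) ^ (k + 2)) / RtoC (INR (k + 2)) +
      (1 / 2 - alpha) * (alpha ^ (k + 1) - (alpha - 1) ^ (k + 1))
        / RtoC (INR (k + 1)))%C.
Proof.
replace (k + 2)%nat with (S (S k)) by lia; replace (k + 1)%nat with (S k) by lia.
set (F := fun t => (/ RtoC (INR (S (S k))) * (alpha - 1 + RtoC t) ^ (S (S k)) +
  (1 / 2 - alpha) / RtoC (INR (S k)) * (alpha - 1 + RtoC t) ^ (S k))%C).
generalize (RtoC_INR_neq_0 k) (RtoC_INR_neq_0 (S k)); intros N1 N2.
apply is_CRInt_eq with (F 1 - F 0)%C.
{ unfold F; replace (alpha - 1 + 1)%C with alpha by ring.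
  replace (alpha - 1 + 0)%C with (alpha - 1)%C by ring.
  field; auto. }
apply is_CRInt_derive; intros t _.
- eapply Cderiv_eq; [|apply Cderiv_plus; apply Cderiv_scal;
    apply (Cderiv_pow (fun s => alpha - 1 + RtoC s)%C); apply Cderiv_shift].
  rewrite Cpow_S; field; auto.
- apply Ccont_mult.
  + apply Ccont_minus; [apply Ccont_id | apply Ccont_const].
  + apply Ccont_pow, Ccont_shift.
Qed.

Lemma is_CRInt_binet_poly m (alpha : C) :
  is_CRInt (fun t => (RtoC t - 1 / 2) * rising (alpha - 1 + RtoC t) m)%C 0 1
    (RtoC (INR m) * binet_poly m alpha)%C.
Proof.
destruct m as [|m].
- generalize (is_CRInt_monomial alpha 0); apply is_CRInt_eq.
  replace (INR (0 + 2)) with 2 by (simpl; ring); replace (INR (0 + 1)) with 1 by reflexivity.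
  simpl INR; simpl Nat.add; simpl Cpow; field; apply (RtoC_INR_neq_0 1).
- unfold binet_poly; rewrite Csum1_Csumlt, Cmult_assoc.
  replace (RtoC (INR (S m)) * (1 / RtoC (INR (S m))))%C with (RtoC 1)
    by (field; apply RtoC_INR_neq_0).
  rewrite Cmult_1_l.
  eapply is_CRInt_ext; [|apply is_CRInt_Csumlt; intros k _; apply is_CRInt_eq with
   (RtoC (powerRZ (- 1) (Z.of_nat (S k) - Z.of_nat (S m))) *
    RtoC (IZR (stirling1 (S m) (S k))) *
    ((alpha ^ (S k + 2) - (alpha - 1) ^ (S k + 2)) / RtoC (INR (S k + 2)) +
      (1 / 2 - alpha) * (alpha ^ (S k + 1) - (alpha - 1) ^ (S k + 1))
        / RtoC (INR (S k + 1))))%C; [ring|]; apply is_CRInt_scal, is_CRInt_monomial].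
  intros t _; cbv beta; rewrite rising_stirling1, <- Csumlt_scal.
  apply Csumlt_ext; intros k _; ring.
Qed.

Lemma binet_poly_segment_int m (alpha : C) : (1 <= m)%nat ->
  binet_poly m alpha =
     (1 / RtoC (INR m) *
      Csegment_int (fun x =>
        (x + 1 / 2 - alpha) * Cprod (fun k => RtoC (INR k) + x) m)
        (alpha - 1) alpha)%C.
Proof.
intros Hm; destruct m as [|m]; [lia|].
unfold Csegment_int; replace (alpha - (alpha - 1))%C with (RtoC 1) by ring.
match goal with |- context [RInt ?f 0 1] => change (RInt (V := C_R_CompleteNormedModule) f 0 1) with (CRInt f 0 1) end.
rewrite (CRInt_unique _ _ _ (RtoC (INR (S m)) * binet_poly (S m) alpha)%C).
- field; apply RtoC_INR_neq_0.
- eapply is_CRInt_ext; [|apply is_CRInt_binet_poly].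
  intros t _; cbv beta; unfold rising.
  replace (alpha - 1 + RtoC t * 1)%C with (alpha - 1 + RtoC t)%C by ring.
  replace (alpha - 1 + RtoC t + 1 / 2 - alpha)%C with (RtoC t - 1 / 2)%C
    by (field; apply (RtoC_INR_neq_0 1)).
  reflexivity.
Qed.

Lemma rising_add (a y : C) m :
  rising (a + y) m =
  Csumlt (fun k => RtoC (Binomial.C m k) * rising a (m - k) * rising y k)%C (S m).
Proof.
induction m as [|m IH].
- simpl; rewrite C_n_0; unfold rising; simpl; ring.
- rewrite rising_S, IH.
  set (u := fun k => (RtoC (Binomial.C m k) * rising a (S m - k) * rising y k)%C).
  set (v := fun k => (RtoC (Binomial.C m k) * rising a (m - k) * rising y (S k))%C).
  transitivity (Csumlt u (S m) + Csumlt v (S m))%C.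
  { rewrite <- Csumlt_plus, Cmult_comm, <- Csumlt_scal.
    apply Csumlt_ext; intros k Hk; unfold u, v.
    replace (S m - k)%nat with (S (m - k)) by lia; rewrite !rising_S.
    replace (RtoC (INR m)) with (RtoC (INR (m - k)) + RtoC (INR k))%C
      by (rewrite <- RtoC_plus, <- plus_INR; do 2 f_equal; lia).
    ring. }
  rewrite (Csumlt_shift _ (S m)), (Csumlt_shift u).
  simpl Csumlt; unfold u at 1, v at 2.
  rewrite !C_n_0, !C_n_n.
  rewrite (Csumlt_ext (fun k => RtoC (Binomial.C (S m) (S k)) * rising a (m - k) * rising y (S k))%C
    (fun k => u (S k) + v k)%C).
  + rewrite Csumlt_plus; change (rising y 0) with (RtoC 1); change (rising a 0) with (RtoC 1).
    ring.
  + intros k Hk; unfold u, v; rewrite <- pascal by lia; rewrite RtoC_plus; simpl Nat.sub; ring.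
Qed.

Lemma binet_poly_binet_num m (alpha : C) : (1 <= m)%nat ->
  binet_poly m alpha =
     (binet_num m +
      alpha *
      Csum (fun k =>
        RtoC (Binomial.C (m - 1) (k - 1)) *
        Cprod (fun j => alpha + RtoC (INR (j + 1))) (m - k - 1) *
        binet_num k) 1 (m - 1))%C.
Proof.
intros Hm; destruct m as [|m]; [lia|]; replace (S m - 1)%nat with m by lia.
assert (E : (RtoC (INR (S m)) * binet_poly (S m) alpha =
  Csumlt (fun k => RtoC (Binomial.C (S m) k) * rising alpha (S m - k) *
    (RtoC (INR k) * binet_num k)) (S (S m)))%C).
{ rewrite <- (CRInt_unique _ _ _ _ (is_CRInt_binet_poly (S m) alpha)).
  apply CRInt_unique; eapply is_CRInt_ext; [|apply is_CRInt_Csumlt; intros k _;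
    apply is_CRInt_scal, (is_CRInt_binet_poly k 0)].
  intros t _; cbv beta.
  replace (alpha - 1 + RtoC t)%C with (alpha + (0 - 1 + RtoC t))%C by ring.
  rewrite rising_add, <- Csumlt_scal; apply Csumlt_ext; intros; ring. }
rewrite Csumlt_shift, Csumlt_S in E; change (INR 0) with 0 in E.
rewrite C_n_n, Nat.sub_diag in E; change (rising alpha 0) with (RtoC 1) in E.
apply (f_equal (fun u => (/ RtoC (INR (S m)) * u)%C)) in E.
generalize (RtoC_INR_neq_0 m); intros N.
rewrite Cmult_assoc, Cinv_l, Cmult_1_l in E by auto; rewrite E.
rewrite Csum1_Csumlt, <- Csumlt_scal.
transitivity (binet_num (S m) + / RtoC (INR (S m)) *
   Csumlt (fun k => RtoC (Binomial.C (S m) (S k)) * rising alpha (S m - S k) *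
     (RtoC (INR (S k)) * binet_num (S k))) m)%C; [field; auto|].
rewrite <- Csumlt_scal; f_equal; apply Csumlt_ext; intros k Hk.
replace (S m - S k - 1)%nat with (m - S k)%nat by lia; replace (S k - 1)%nat with k by lia.
replace (S m - S k)%nat with (S (m - S k)) by lia.
unfold rising; rewrite Cprod_shift.
rewrite (Cprod_ext (fun j => RtoC (INR (S j)) + alpha)%C (fun j => alpha + RtoC (INR (j + 1)))%C)
  by (intros; rewrite Nat.add_1_r; ring).
assert (B : Binomial.C (S m) (S k) * INR (S k) = INR (S m) * Binomial.C m k).
{ unfold Binomial.C; replace (S m - S k)%nat with (m - k)%nat by lia.
  rewrite !fact_simpl, !mult_INR; field; repeat split; try apply INR_fact_neq_0;
  apply not_0_INR; lia. }
simpl (INR 0).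
transitivity (/ RtoC (INR (S m)) * RtoC (Binomial.C (S m) (S k) * INR (S k)) *
  (alpha * Cprod (fun j => alpha + RtoC (INR (j + 1))) (m - S k) * binet_num (S k)))%C.
- rewrite RtoC_mult; ring.
- rewrite B, RtoC_mult; field; auto.
Qed.

Lemma binet_poly_1 (alpha : C) : binet_poly 1 alpha = (1 / 12)%C.
Proof.
unfold binet_poly; rewrite Csum1_Csumlt; unfold Csumlt; rewrite !INR_IZR_INZ; simpl.
field; repeat split; intros H; apply RtoC_inj in H; lra.
Qed.

Lemma binet_poly_2 (alpha : C) : binet_poly 2 alpha = (alpha / 12)%C.
Proof.
unfold binet_poly; rewrite Csum1_Csumlt; unfold Csumlt; rewrite !INR_IZR_INZ; simpl.
replace (- 1 * 1) with (- 1) by ring; replace (/ -1) with (-1) by field.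
field; repeat split; intros H; apply RtoC_inj in H; lra.
Qed.

(** * Convergence of the factorial series *)

Definition Clim (u : nat -> C) (l : C) : Prop := is_lim_seq (fun n => Cmod (u n - l)%C) 0.

Lemma Clim_le (u : nat -> C) (l : C) (e : nat -> R) :
  (forall n, Cmod (u n - l)%C <= e n) -> is_lim_seq e 0 -> Clim u l.
Proof.
intros H E; apply is_lim_seq_le_le with (fun _ => 0) e; auto.
- intros n; split; [apply Cmod_ge_0 | apply H].
- apply is_lim_seq_const.
Qed.

Lemma Clim_ext (u v : nat -> C) (l : C) : (forall n, u n = v n) -> Clim u l -> Clim v l.
Proof. intros H; apply is_lim_seq_ext; intros n; rewrite H; auto. Qed.

Lemma Clim_const (c : C) : Clim (fun _ => c) c.
Proof.
apply Clim_le with (fun _ => 0); [|apply is_lim_seq_const].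
intros _; unfold Cminus; rewrite Cplus_opp_r, Cmod_0; lra.
Qed.

Lemma Clim_plus (u v : nat -> C) (l m : C) :
  Clim u l -> Clim v m -> Clim (fun n => u n + v n)%C (l + m).
Proof.
intros p q; apply Clim_le with (fun n => Cmod (u n - l)%C + Cmod (v n - m)%C).
- intros n; replace (u n + v n - (l + m))%C with ((u n - l) + (v n - m))%C by ring.
  apply Cmod_triangle.
- evar_last; [apply is_lim_seq_plus'; [exact p | exact q]|]; f_equal; ring.
Qed.

Lemma Clim_mult (u v : nat -> C) (l m : C) :
  Clim u l -> Clim v m -> Clim (fun n => u n * v n)%C (l * m).
Proof.
intros p q; apply Clim_le with (fun n => Cmod (u n - l)%C * Cmod (v n - m)%C +
  (Cmod (u n - l)%C * Cmod m + Cmod l * Cmod (v n - m)%C)).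
- intros n; rewrite <- !Cmod_mult.
  replace (u n * v n - l * m)%C
    with ((u n - l) * (v n - m) + ((u n - l) * m + l * (v n - m)))%C by ring.
  eapply Rle_trans; [apply Cmod_triangle|]; apply Rplus_le_compat_l, Cmod_triangle.
- evar_last.
  + apply is_lim_seq_plus'; [|apply is_lim_seq_plus'].
    * apply is_lim_seq_mult'; [exact p | exact q].
    * apply is_lim_seq_mult'; [exact p | apply is_lim_seq_const].
    * apply is_lim_seq_mult'; [apply is_lim_seq_const | exact q].
  + f_equal; ring.
Qed.

Lemma Clim_scal (c : C) (u : nat -> C) (l : C) : Clim u l -> Clim (fun n => c * u n)%C (c * l).
Proof. apply (Clim_mult (fun _ => c) u c l), Clim_const. Qed.

Lemma Clim_minus (u v : nat -> C) (l m : C) :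
  Clim u l -> Clim v m -> Clim (fun n => u n - v n)%C (l - m).
Proof.
intros p q; apply (Clim_ext (fun n => u n + - (1) * v n)%C); [intros; ring|].
replace (l - m)%C with (l + - (1) * m)%C by ring.
apply Clim_plus; auto; apply Clim_scal; auto.
Qed.

Lemma Clim_bound (u : nat -> C) (l : C) (B : R) :
  (forall n, Cmod (u n) <= B) -> Clim u l -> Cmod l <= B.
Proof.
intros H p.
assert (L : is_lim_seq (fun n => B + Cmod (u n - l)%C) (B + 0)).
{ apply is_lim_seq_plus'; [apply is_lim_seq_const | exact p]. }
assert (Q : Rbar_le (Cmod l) (B + 0)).
{ apply (is_lim_seq_le (fun _ => Cmod l) (fun n => B + Cmod (u n - l)%C)); auto.
  - intros n; replace l with (u n - (u n - l))%C at 1 by ring.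
    eapply Rle_trans; [apply Cmod_triangle|]; rewrite Cmod_opp; generalize (H n); lra.
  - apply is_lim_seq_const. }
simpl in Q; lra.
Qed.

Lemma Clim_unique (u : nat -> C) (l m : C) : Clim u l -> Clim u m -> l = m.
Proof.
intros p q; generalize (Clim_minus _ _ _ _ p q); intros r.
assert (E : Cmod (l - m)%C <= 0).
{ apply (Clim_bound (fun n => u n - u n)%C); auto.
  intros n; unfold Cminus; rewrite Cplus_opp_r, Cmod_0; lra. }
apply Ceq_minus, Cmod_eq_0; generalize (Cmod_ge_0 (l - m)%C); lra.
Qed.

Lemma Clim_S (u : nat -> C) (l : C) : Clim u l <-> Clim (fun n => u (S n)) l.
Proof. apply (is_lim_seq_incr_1 (fun n => Cmod (u n - l)%C)). Qed.

Lemma is_series_Clim (a : nat -> C) (l : C) :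
  is_series (K := C_AbsRing) (V := C_NormedModule) a l <-> Clim (Csumlt a) l.
Proof.
assert (E : forall n, sum_n (G := C_NormedModule) a n = Csumlt a (S n))
  by exact (Csum0_Csumlt a).
rewrite Clim_S; unfold is_series.
rewrite (filterlim_locally_ball_norm (K := C_AbsRing) (U := C_NormedModule) (sum_n (G := C_NormedModule) a) l).
unfold Clim; rewrite <- is_lim_seq_spec; unfold is_lim_seq'; split; intros H eps.
- generalize (H eps); apply filter_imp; intros n; rewrite E; unfold ball_norm.
  rewrite Rminus_0_r, Rabs_pos_eq by apply Cmod_ge_0; auto.
- generalize (H eps); apply filter_imp; intros n; rewrite E; unfold ball_norm.
  rewrite Rminus_0_r, Rabs_pos_eq by apply Cmod_ge_0; auto.
Qed.

Lemma Cmod_rising_pos (w : C) m : 0 < Re w -> 0 < Cmod (rising w m).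
Proof.
intros H; induction m as [|m IH]; [unfold rising; simpl; rewrite Cmod_1; lra|].
rewrite rising_S, Cmod_mult; apply Rmult_lt_0_compat; auto.
apply Rlt_le_trans with (2 := Re_le_Cmod _); simpl; fold (Re w); generalize (pos_INR m); lra.
Qed.

Lemma rising_neq_0 (w : C) m : 0 < Re w -> rising w m <> 0%C.
Proof. intros H; apply Cmod_gt_0, Cmod_rising_pos; auto. Qed.

Lemma Cmod_le_sqr (u v : C) :
  Re u * Re u + Im u * Im u <= Re v * Re v + Im v * Im v -> Cmod u <= Cmod v.
Proof.
rewrite <- !Cmod_sqr; intros H; generalize (Cmod_ge_0 u) (Cmod_ge_0 v); nra.
Qed.

(* [|w + k|^2 - |alpha + k|^2] grows like [2 k Re z]. *)
Lemma rising_factor_ratio (z alpha : C) : 0 < Re z -> - Re z < Re alpha ->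
  exists (k0 : nat) (d K : R), 0 < d < K /\
  forall (k : nat) (t : R), (k0 <= k)%nat -> 0 <= t <= 1 ->
    Cmod (RtoC (INR k) + (alpha - 1 + RtoC t))%C <=
    (1 - d / (INR k + K)) * Cmod (RtoC (INR k) + (z + alpha))%C.
Proof.
intros Hz Ha; set (x := Re z) in *; set (d := x / 2).
set (M := 1 + Rabs (Re alpha) +
  (x * Cmod alpha + x * x + 2 * x * Rabs (Re alpha) + 2 * Rabs (Im z) * Rabs (Im alpha)) / x).
destruct (nfloor_ex M) as [k0 [_ Hk0]].
{ unfold M; apply Rplus_le_le_0_compat.
  - generalize (Rabs_pos (Re alpha)); lra.
  - apply Rdiv_le_0_compat; auto.
    generalize (Rabs_pos (Re alpha)) (Rabs_pos (Im z)) (Rabs_pos (Im alpha)) (Cmod_ge_0 alpha).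
    intros; repeat apply Rplus_le_le_0_compat; repeat apply Rmult_le_pos; lra. }
set (K := Cmod (z + alpha)%C + 1 + d).
exists (S k0), d, K; split.
{ unfold K; generalize (Cmod_ge_0 (z + alpha)%C); unfold d; lra. }
intros k t Hk Ht.
assert (HM : M <= INR k).
{ apply Rlt_le, Rlt_le_trans with (1 := Hk0); rewrite <- S_INR; apply le_INR; auto. }
assert (HM' : x * (1 + Rabs (Re alpha)) + (x * Cmod alpha + x * x + 2 * x * Rabs (Re alpha) + 2 * Rabs (Im z) * Rabs (Im alpha)) <= x * INR k).
{ replace (x * (1 + Rabs (Re alpha)) + (x * Cmod alpha + x * x + 2 * x * Rabs (Re alpha) + 2 * Rabs (Im z) * Rabs (Im alpha)))
    with (x * M) by (unfold M; field; lra).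
  apply Rmult_le_compat_l; lra. }
assert (HM1 : 1 + Rabs (Re alpha) <= INR k).
{ apply Rle_trans with (2 := HM); unfold M.
  rewrite <- (Rplus_0_r (1 + Rabs (Re alpha))) at 1; apply Rplus_le_compat_l.
  apply Rdiv_le_0_compat; auto.
  generalize (Rabs_pos (Re alpha)) (Rabs_pos (Im z)) (Rabs_pos (Im alpha)) (Cmod_ge_0 alpha).
  intros; repeat apply Rplus_le_le_0_compat; repeat apply Rmult_le_pos; lra. }
clear HM Hk0; set (s := Cmod (RtoC (INR k) + (z + alpha))%C).
set (r := Cmod (RtoC (INR k) + alpha)%C).
assert (A1 : - Rabs (Re alpha) <= Re alpha) by (generalize (Rle_abs (- Re alpha)); rewrite Rabs_Ropp; lra).
assert (S1 : Cmod (RtoC (INR k) + (alpha - 1 + RtoC t))%C <= r).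
{ apply Cmod_le_sqr; simpl; fold (Re alpha) (Im alpha); nra. }
assert (S2 : r + d <= s).
{ assert (R1 : r <= INR k + Cmod alpha).
  { unfold r; eapply Rle_trans; [apply Cmod_triangle|].
    rewrite Cmod_R, Rabs_pos_eq by apply pos_INR; lra. }
  assert (R0 : 0 <= r) by apply Cmod_ge_0.
  assert (s0 : 0 <= s) by apply Cmod_ge_0.
  assert (I1 : - (Rabs (Im z) * Rabs (Im alpha)) <= Im z * Im alpha).
  { rewrite <- Rabs_mult; generalize (Rle_abs (- (Im z * Im alpha))); rewrite Rabs_Ropp; lra. }
  assert (Q : (r + d) * (r + d) <= s * s).
  { assert (rr : r * r = (INR k + Re alpha) * (INR k + Re alpha) + Im alpha * Im alpha).
    { unfold r; rewrite Cmod_sqr; simpl; fold (Re alpha) (Im alpha); ring. }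
    assert (ss : s * s = (INR k + (x + Re alpha)) * (INR k + (x + Re alpha)) + (Im z + Im alpha) * (Im z + Im alpha)).
    { unfold s; rewrite Cmod_sqr; simpl; fold (Re alpha) (Im alpha) (Re z) (Im z); unfold x; ring. }
    assert (xa : - (x * Rabs (Re alpha)) <= x * Re alpha) by nra.
    assert (dr : 2 * d * r <= x * INR k + x * Cmod alpha) by (unfold d; nra).
    assert (xx : 0 < x * x) by (apply Rmult_lt_0_compat; auto).
    assert (dd : d * d <= x * x) by (unfold d; nra).
    assert (xb : 0 <= x * (1 + Rabs (Re alpha))) by (generalize (Rabs_pos (Re alpha)); nra).
    assert (yy : 0 <= Im z * Im z) by nra.
    nra. }
  nra. }
assert (S3 : s <= INR k + K).
{ unfold s; eapply Rle_trans; [apply Cmod_triangle|].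
  rewrite Cmod_R, Rabs_pos_eq by apply pos_INR; unfold K, d; lra. }
assert (kK : 0 < INR k + K).
{ generalize (pos_INR k) (Cmod_ge_0 (z + alpha)%C); unfold K, d; lra. }
assert (S4 : d / (INR k + K) * s <= d).
{ unfold Rdiv; rewrite Rmult_assoc; rewrite <- (Rmult_1_r d) at 2.
  apply Rmult_le_compat_l; [unfold d; lra|].
  apply Rmult_le_reg_l with (INR k + K); auto.
  rewrite <- Rmult_assoc, Rinv_r by lra; lra. }
lra.
Qed.

Lemma exp_le_mono x y : x <= y -> exp x <= exp y.
Proof. intros [H | ->]; [apply Rlt_le, exp_increasing; auto | apply Rle_refl]. Qed.

Fixpoint decay (d K : R) (m : nat) : R :=
  match m with
  | O => 1
  | S n => decay d K n * (1 - d / (INR n + K))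
  end.

Lemma decay_factor_pos d K k : 0 < d < K -> 0 < 1 - d / (INR k + K).
Proof.
intros H; assert (P : 0 < INR k + K) by (generalize (pos_INR k); lra).
apply Rmult_lt_reg_l with (INR k + K); auto.
replace ((INR k + K) * (1 - d / (INR k + K))) with (INR k + K - d) by (field; lra).
generalize (pos_INR k); lra.
Qed.

Lemma decay_pos d K m : 0 < d < K -> 0 < decay d K m.
Proof.
intros H; induction m as [|m IH]; simpl; [lra|].
apply Rmult_lt_0_compat; auto; apply decay_factor_pos; auto.
Qed.

Lemma decay_lim d K : 0 < d < K -> is_lim_seq (decay d K) 0.
Proof.
intros H.
assert (B : forall m, decay d K m <= exp (- d * (ln (INR m + K) - ln K))).
{ induction m as [|m IH].
  - simpl; rewrite Rplus_0_l; replace (- d * (ln K - ln K)) with 0 by ring; rewrite exp_0; lra.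
  - assert (P : 0 < INR m + K) by (generalize (pos_INR m); lra).
    apply Rle_trans with (exp (- d * (ln (INR m + K) - ln K)) * exp (- (d / (INR m + K)))).
    + simpl decay; apply Rmult_le_compat; auto.
      * apply Rlt_le, decay_pos; auto.
      * apply Rlt_le, decay_factor_pos; auto.
      * generalize (exp_ineq1_le (- (d / (INR m + K)))); lra.
    + rewrite <- exp_plus; apply exp_le_mono.
      assert (L : ln (INR (S m) + K) <= ln (INR m + K) + / (INR m + K)).
      { rewrite <- (ln_exp (/ (INR m + K))), <- ln_mult by (auto; apply exp_pos).
        rewrite S_INR; apply ln_le; [lra|].
        apply Rle_trans with ((INR m + K) * (1 + / (INR m + K))).
        - rewrite Rmult_plus_distr_l, Rinv_r by lra; lra.
        - apply Rmult_le_compat_l; [lra|]; apply exp_ineq1_le. }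
      unfold Rdiv; nra. }
apply is_lim_seq_le_le with (fun _ => 0) (fun m => exp (- d * (ln (INR m + K) - ln K))).
- intros m; split; auto; apply Rlt_le, decay_pos; auto.
- apply is_lim_seq_const.
- apply (filterlim_comp _ _ _ (fun m => - d * (ln (INR m + K) - ln K)) exp eventually
    (Rbar_locally m_infty)); [|exact is_lim_exp_m].
  assert (A : is_lim_seq (fun m => ln (INR m + K) - ln K) p_infty).
  { apply is_lim_seq_minus with p_infty (ln K).
    - apply (filterlim_comp _ _ _ (fun m => INR m + K) ln eventually
        (Rbar_locally p_infty)); [|exact is_lim_ln_p].
      apply is_lim_seq_plus with p_infty K; [apply is_lim_seq_INR | apply is_lim_seq_const | reflexivity].
    - apply is_lim_seq_const.
    - reflexivity. }
  generalize (is_lim_seq_scal_l _ (- d) _ A).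
  replace (Rbar_mult (- d) p_infty) with m_infty; auto.
  symmetry; rewrite Rbar_mult_comm; apply is_Rbar_mult_unique, is_Rbar_mult_p_infty_neg; simpl; lra.
Qed.

Lemma rising_ratio_bound (z alpha : C) : 0 < Re z -> - Re z < Re alpha ->
  exists (d K : R) (v : nat -> R), 0 < d /\ 0 < K /\ is_lim_seq v 0 /\
    (forall m, 0 <= v m) /\
    (forall m, d * v m = (INR m + K) * (v m - v (S m))) /\
    (forall m t, 0 <= t <= 1 ->
      Cmod (rising (alpha - 1 + RtoC t) m) <= v m * Cmod (rising (z + alpha) m)).
Proof.
intros Hz Ha; destruct (rising_factor_ratio z alpha Hz Ha) as (k0 & d & K & Hd & H).
assert (Hw : 0 < Re (z + alpha)%C) by (simpl; fold (Re z) (Re alpha); lra).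
assert (T : forall m, exists c, 0 <= c /\ forall t, 0 <= t <= 1 -> Cmod (rising (alpha - 1 + RtoC t) m) <= c).
{ induction m as [|m [c [Hc IH]]].
  - exists 1; split; [lra|]; intros; unfold rising; simpl; rewrite Cmod_1; lra.
  - exists (c * (INR m + (Cmod alpha + 1))); split.
    + apply Rmult_le_pos; auto; generalize (pos_INR m) (Cmod_ge_0 alpha); lra.
    + intros t Ht; rewrite rising_S, Cmod_mult; apply Rmult_le_compat; auto; try apply Cmod_ge_0.
      eapply Rle_trans; [apply Cmod_triangle|]; rewrite Cmod_R, Rabs_pos_eq by apply pos_INR.
      apply Rplus_le_compat_l; replace (alpha - 1 + RtoC t)%C with (alpha + RtoC (t - 1))%C
        by (rewrite RtoC_minus; ring).
      eapply Rle_trans; [apply Cmod_triangle|]; apply Rplus_le_compat_l.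
      rewrite Cmod_R; apply Rabs_le; lra. }
assert (D : forall m, 0 < decay d K m * Cmod (rising (z + alpha) m)).
{ intros m; apply Rmult_lt_0_compat; [apply decay_pos | apply Cmod_rising_pos]; auto. }
assert (I : forall n, exists c, 0 <= c /\ forall m t, (m <= n)%nat -> 0 <= t <= 1 ->
  Cmod (rising (alpha - 1 + RtoC t) m) <= c * decay d K m * Cmod (rising (z + alpha) m)).
{ assert (I1 : forall m, exists c, 0 <= c /\ forall t, 0 <= t <= 1 ->
    Cmod (rising (alpha - 1 + RtoC t) m) <= c * decay d K m * Cmod (rising (z + alpha) m)).
  { intros m; destruct (T m) as [c [Hc Tc]]; generalize (D m); intros Dm.
    exists (c / (decay d K m * Cmod (rising (z + alpha) m))); split.
    - apply Rdiv_le_0_compat; auto.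
    - intros t Ht; rewrite Rmult_assoc; unfold Rdiv.
      rewrite Rmult_assoc, Rinv_l by lra; rewrite Rmult_1_r; auto. }
  induction n as [|n [c [Hc IH]]].
  - destruct (I1 O) as [c [Hc Ic]]; exists c; split; auto.
    intros m t Hm; replace m with O by lia; auto.
  - destruct (I1 (S n)) as [c' [Hc' Ic']]; exists (c + c'); split; [lra|].
    intros m t Hm Ht; generalize (D m); intros Dm; rewrite Rmult_assoc, Rmult_plus_distr_r.
    destruct (Nat.eq_dec m (S n)) as [->|N].
    + generalize (Ic' t Ht); rewrite Rmult_assoc; nra.
    + generalize (IH m t ltac:(lia) Ht); rewrite Rmult_assoc; nra. }
destruct (I k0) as [c [Hc Ic]].
exists d, K, (fun m => c * decay d K m); repeat split; try lra.
- evar_last; [apply (is_lim_seq_scal_l _ c), decay_lim; auto|]; simpl; f_equal; ring.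
- intros m; apply Rmult_le_pos; auto; apply Rlt_le, decay_pos; auto.
- intros m; simpl; field; generalize (pos_INR m); lra.
- intros m t Ht; induction m as [|m IH]; [apply Ic; auto; lia|].
  destruct (le_lt_dec (S m) k0) as [L|L]; [apply Ic; auto|].
  rewrite !rising_S, !Cmod_mult; simpl decay.
  replace (c * (decay d K m * (1 - d / (INR m + K))) *
     (Cmod (rising (z + alpha) m) * Cmod (RtoC (INR m) + (z + alpha))%C)) with
   ((c * decay d K m * Cmod (rising (z + alpha) m)) *
    ((1 - d / (INR m + K)) * Cmod (RtoC (INR m) + (z + alpha))%C)) by ring.
  apply Rmult_le_compat; auto; try apply Cmod_ge_0; apply H; auto; lia.
Qed.

Definition gudermann (z : C) : C := ((z + 1 / 2) * (Clog (z + 1) - Clog z) - 1)%C.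

Lemma Cmod_ge_Re (z : C) x : x <= Re z -> x <= Cmod z.
Proof. intros H; apply Rle_trans with (1 := H), Re_le_Cmod. Qed.

Lemma Re_shift_pos (z : C) t : 0 < Re z -> t <= 1 -> 0 < Re (z + 1 - RtoC t)%C.
Proof. intros; simpl; fold (Re z); lra. Qed.

Lemma Ccont_kernel (z : C) t : 0 < Re z -> t <= 1 ->
  Ccont (fun s => (RtoC s - 1 / 2) / (z + 1 - RtoC s))%C t.
Proof.
intros Hz Ht; apply Ccont_div.
- apply Re_pos_neq_0, Re_shift_pos; auto.
- apply Ccont_minus; [apply Ccont_id | apply Ccont_const].
- apply Ccont_minus; [apply Ccont_const | apply Ccont_id].
Qed.

Lemma is_CRInt_gudermann (z : C) : 0 < Re z ->
  is_CRInt (fun t => (RtoC t - 1 / 2) / (z + 1 - RtoC t))%C 0 1 (gudermann z).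
Proof.
intros Hz.
set (F := fun t => (- RtoC t - (z + 1 / 2) * Clog (z + 1 - RtoC t))%C).
apply is_CRInt_eq with (F 1 - F 0)%C.
{ unfold F, gudermann; replace (z + 1 - 1)%C with z by ring.
  replace (z + 1 - 0)%C with (z + 1)%C by ring; ring. }
apply is_CRInt_derive; intros t Ht; rewrite Rmin_left, Rmax_right in Ht by lra.
- assert (N : (z + 1 - RtoC t)%C <> 0%C) by (apply Re_pos_neq_0, Re_shift_pos; lra).
  eapply Cderiv_eq; [|apply Cderiv_minus; [apply Cderiv_opp, Cderiv_id |
    apply Cderiv_scal, (Cderiv_Clog (fun s => z + 1 - RtoC s)%C);
    [apply Re_shift_pos; lra |
     apply Cderiv_minus; [apply Cderiv_const | apply Cderiv_id]]]].
  field; repeat split; auto; apply (RtoC_INR_neq_0 1).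
- apply Ccont_kernel; lra.
Qed.

Lemma Cmod_centered t : 0 <= t <= 1 -> Cmod (RtoC t - 1 / 2)%C <= / 2.
Proof.
intros H; replace (RtoC t - 1 / 2)%C with (RtoC (t - / 2)).
- rewrite Cmod_R; apply Rabs_le; lra.
- rewrite RtoC_minus, RtoC_inv by lra; field; apply (RtoC_INR_neq_0 1).
Qed.

Lemma gudermann_lipschitz (z z' : C) x : 0 < x -> x <= Re z -> x <= Re z' ->
  Cmod (gudermann z - gudermann z')%C <= / 2 * Cmod (z' - z)%C / (x * x).
Proof.
intros Hx Hz Hz'.
assert (P : 0 < Re z) by lra. assert (P' : 0 < Re z') by lra.
generalize (is_CRInt_minus _ _ _ _ _ _ (is_CRInt_gudermann z P) (is_CRInt_gudermann z' P')).
apply is_CRInt01_le; intros t Ht.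
assert (N : (z + 1 - RtoC t)%C <> 0%C) by (apply Re_pos_neq_0, Re_shift_pos; lra).
assert (N' : (z' + 1 - RtoC t)%C <> 0%C) by (apply Re_pos_neq_0, Re_shift_pos; lra).
assert (M : x <= Cmod (z + 1 - RtoC t)%C) by (apply Cmod_ge_Re; simpl; fold (Re z); lra).
assert (M' : x <= Cmod (z' + 1 - RtoC t)%C) by (apply Cmod_ge_Re; simpl; fold (Re z'); lra).
replace ((RtoC t - 1 / 2) / (z + 1 - RtoC t) - (RtoC t - 1 / 2) / (z' + 1 - RtoC t))%C
  with ((RtoC t - 1 / 2) * (z' - z) / ((z + 1 - RtoC t) * (z' + 1 - RtoC t)))%C
  by (field; repeat split; auto; apply (RtoC_INR_neq_0 1)).
rewrite Cmod_div, !Cmod_mult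
  by (apply Cmod_gt_0; rewrite Cmod_mult; apply Rmult_lt_0_compat; lra).
assert (X : 0 < x * x) by nra.
unfold Rdiv; apply Rmult_le_compat.
- apply Rmult_le_pos; apply Cmod_ge_0.
- apply Rlt_le, Rinv_0_lt_compat; nra.
- apply Rmult_le_compat_r; [apply Cmod_ge_0 | apply Cmod_centered; auto].
- apply Rinv_le_contravar; nra.
Qed.

Definition binet_term (z alpha : C) (m : nat) : C :=
  (binet_poly m alpha / rising (z + alpha) m)%C.

Lemma Cmod_binet_poly_le (alpha : C) m B :
  (forall t, 0 <= t <= 1 -> Cmod (rising (alpha - 1 + RtoC t) m) <= B) ->
  INR m * Cmod (binet_poly m alpha) <= / 2 * B.
Proof.
intros H; rewrite <- (Rabs_pos_eq (INR m)) by apply pos_INR.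
rewrite <- Cmod_R, <- Cmod_mult.
generalize (is_CRInt_binet_poly m alpha); apply is_CRInt01_le; intros t Ht.
rewrite Cmod_mult; apply Rmult_le_compat; try apply Cmod_ge_0; auto.
apply Cmod_centered; auto.
Qed.

Lemma binet_term_bound (z alpha : C) : 0 < Re z -> - Re z < Re alpha ->
  exists (c : R) (v : nat -> R), is_lim_seq v 0 /\ (forall m, 0 <= v m) /\ 0 <= c /\
    (forall m, (1 <= m)%nat -> Cmod (binet_term z alpha m) <= c * (v m - v (S m))).
Proof.
intros Hz Ha.
destruct (rising_ratio_bound z alpha Hz Ha) as (d & K & v & Hd & HK & Lv & v0 & Dv & Rv).
exists (/ 2 * (1 + K) / d), v; repeat split; auto.
{ apply Rdiv_le_0_compat; lra. }
intros m Hm; unfold binet_term.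
assert (Hw : 0 < Re (z + alpha)%C) by (simpl; fold (Re z) (Re alpha); lra).
assert (P := Cmod_rising_pos (z + alpha) m Hw).
assert (m1 : 1 <= INR m) by (apply (le_INR 1); auto).
generalize (Cmod_binet_poly_le alpha m _ (fun t Ht => Rv m t Ht)); intros B.
rewrite Cmod_div by (apply rising_neq_0; auto).
apply Rmult_le_reg_r with (Cmod (rising (z + alpha) m)); auto.
unfold Rdiv at 1; rewrite Rmult_assoc, Rinv_l, Rmult_1_r by lra.
apply Rmult_le_reg_l with (INR m); [lra|].
apply Rle_trans with (1 := B).
assert (E : v m - v (S m) = d * v m / (INR m + K)) by (rewrite Dv; field; lra).
rewrite E.
replace (INR m * (/ 2 * (1 + K) / d * (d * v m / (INR m + K)) * Cmod (rising (z + alpha) m)))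
  with (/ 2 * (v m * Cmod (rising (z + alpha) m)) * (INR m * (1 + K) / (INR m + K)))
  by (field; lra).
rewrite <- (Rmult_1_r (/ 2 * _)) at 1; apply Rmult_le_compat_l.
- apply Rmult_le_pos; [lra|]; apply Rmult_le_pos; auto; lra.
- apply Rmult_le_reg_r with (INR m + K); [lra|].
  unfold Rdiv; rewrite Rmult_assoc, Rinv_l by lra; nra.
Qed.

Lemma ex_series_telescope (v : nat -> R) (c : R) :
  is_lim_seq v 0 -> ex_series (fun n => c * (v n - v (S n))).
Proof.
intros L; exists (c * (v O - 0)).
apply (is_series_scal_l (K := R_AbsRing) (V := R_NormedModule) c (fun n => v n - v (S n)) (v O - 0)).
assert (E : forall n, sum_n (fun n => v n - v (S n)) n = v O - v (S n)).
{ induction n as [|n IH]; [apply sum_O|].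
  rewrite sum_Sn, IH; unfold plus; simpl; ring. }
change (is_lim_seq (sum_n (fun n => v n - v (S n))) (v O - 0)).
apply (is_lim_seq_ext (fun n => v O - v (S n))); [intros; symmetry; apply E|].
apply is_lim_seq_minus'; [apply is_lim_seq_const|].
apply (is_lim_seq_incr_1 v); auto.
Qed.

Lemma ex_series_Cmod_binet_term (z alpha : C) : 0 < Re z -> - Re z < Re alpha ->
  ex_series (fun n => Cmod (binet_term z alpha (S n))).
Proof.
intros Hz Ha; destruct (binet_term_bound z alpha Hz Ha) as (c & v & Lv & v0 & c0 & B).
apply (ex_series_le (K := R_AbsRing) (V := R_CompleteNormedModule) _ (fun n => c * (v (S n) - v (S (S n))))).
- intros n; unfold norm; simpl; unfold abs; simpl.
  rewrite Rabs_pos_eq by apply Cmod_ge_0; apply B; lia.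
- apply (ex_series_telescope (fun n => v (S n))).
  apply (is_lim_seq_incr_1 v); auto.
Qed.

Lemma ex_Clim_Csumlt (a : nat -> C) :
  ex_series (fun n => Cmod (a n)) -> exists l, Clim (Csumlt a) l.
Proof.
intros H.
destruct (ex_series_le (K := C_AbsRing) (V := C_CompleteNormedModule) a (fun n => Cmod (a n))) as [l Hl].
- intros n; apply Rle_refl.
- exact H.
- exists l; apply is_series_Clim; exact Hl.
Qed.

Lemma Cmod_Csumlt_le (a : nat -> C) (b : nat -> R) :
  (forall n, Cmod (a n) <= b n) -> ex_series b -> forall n, Cmod (Csumlt a n) <= Series b.
Proof.
intros H E.
assert (b0 : forall n, 0 <= b n) by (intros n; eapply Rle_trans; [apply Cmod_ge_0 | apply H]).
assert (A : forall n, Cmod (Csumlt a (S n)) <= sum_n b n).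
{ induction n as [|n IH].
  - rewrite sum_O; simpl; rewrite Cplus_0_l; auto.
  - rewrite sum_Sn, Csumlt_S; eapply Rle_trans; [apply Cmod_triangle|].
    apply Rplus_le_compat; auto. }
assert (B : forall n, sum_n b n <= Series b).
{ intros n; apply (is_lim_seq_incr_compare (sum_n b)).
  - apply Series_correct; auto.
  - intros m; rewrite sum_Sn; unfold plus; simpl; generalize (b0 (S m)); lra. }
intros [|n]; [|eapply Rle_trans; auto].
simpl; rewrite Cmod_0; eapply Rle_trans; [|apply (B O)]; rewrite sum_O; auto.
Qed.

Lemma rising_shift (w : C) m : rising w (S m) = (w * rising (w + 1) m)%C.
Proof.
unfold rising; rewrite Cprod_shift; f_equal.
- simpl; ring.
- apply Cprod_ext; intros k _; rewrite S_INR, RtoC_plus; ring.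
Qed.

Definition gudermann_rest (z alpha : C) (m : nat) : C :=
  (CRInt (fun t => (RtoC t - 1 / 2) / (z + 1 - RtoC t) * rising (alpha - 1 + RtoC t) m)%C 0 1
    / rising (z + alpha) m)%C.

Lemma is_CRInt_gudermann_rest (z alpha : C) m : 0 < Re z -> 0 < Re (z + alpha)%C ->
  is_CRInt (fun t => (RtoC t - 1 / 2) / (z + 1 - RtoC t) * rising (alpha - 1 + RtoC t) m)%C 0 1
    (rising (z + alpha) m * gudermann_rest z alpha m)%C.
Proof.
intros Hz Hw; unfold gudermann_rest.
eapply is_CRInt_eq; [|apply is_CRInt_cont].
- field; apply rising_neq_0; auto.
- intros t Ht; rewrite Rmin_left, Rmax_right in Ht by lra.
  apply Ccont_mult; [apply Ccont_kernel; lra|].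
  apply Ccont_rising, Ccont_shift.
Qed.

Lemma gudermann_rest_0 (z alpha : C) : 0 < Re z -> gudermann_rest z alpha 0 = gudermann z.
Proof.
intros Hz; unfold gudermann_rest.
rewrite (CRInt_unique _ _ _ (gudermann z)).
- unfold rising; simpl; field; intros H; apply RtoC_inj in H; lra.
- eapply is_CRInt_ext; [|apply is_CRInt_gudermann; auto].
  intros t _; unfold rising; simpl; ring.
Qed.

Lemma gudermann_rest_S (z alpha : C) m : 0 < Re z -> 0 < Re (z + alpha)%C ->
  (gudermann_rest z alpha m - gudermann_rest z alpha (S m))%C =
  (RtoC (INR m) * binet_poly m alpha / rising (z + alpha) (S m))%C.
Proof.
intros Hz Hw.
assert (N := rising_neq_0 (z + alpha) m Hw).
assert (N' := rising_neq_0 (z + alpha) (S m) Hw).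
assert (N1 : (RtoC (INR m) + (z + alpha))%C <> 0%C).
{ intros E; rewrite rising_S, E, Cmult_0_r in N'; auto. }
set (I := (RtoC (INR m) * binet_poly m alpha)%C).
assert (E : ((RtoC (INR m) + (z + alpha)) * (rising (z + alpha) m * gudermann_rest z alpha m) -
  rising (z + alpha) (S m) * gudermann_rest z alpha (S m))%C = I).
{ rewrite <- (CRInt_unique _ _ _ I (is_CRInt_binet_poly m alpha)); symmetry.
  apply CRInt_unique; eapply is_CRInt_ext; [|apply is_CRInt_minus;
   [apply is_CRInt_scal|]; apply is_CRInt_gudermann_rest; auto].
  intros t Ht; rewrite Rmin_left, Rmax_right in Ht by lra; cbv beta; rewrite rising_S.
  field; apply Re_pos_neq_0, Re_shift_pos; lra. }
rewrite <- E, rising_S; field; auto.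
Qed.

Lemma gudermann_rest_lim (z alpha : C) : 0 < Re z -> - Re z < Re alpha ->
  Clim (gudermann_rest z alpha) 0.
Proof.
intros Hz Ha; assert (Hw : 0 < Re (z + alpha)%C) by (simpl; fold (Re z) (Re alpha); lra).
destruct (rising_ratio_bound z alpha Hz Ha) as (d & K & v & Hd & HK & Lv & v0 & Dv & Rv).
apply Clim_le with (fun m => / 2 / Re z * v m).
- intros m; replace (gudermann_rest z alpha m - 0)%C with (gudermann_rest z alpha m) by ring.
  assert (P := Cmod_rising_pos (z + alpha) m Hw).
  apply Rmult_le_reg_l with (Cmod (rising (z + alpha) m)); auto.
  rewrite <- Cmod_mult.
  generalize (is_CRInt_gudermann_rest z alpha m Hz Hw); apply is_CRInt01_le.
  intros t Ht; rewrite Cmod_mult.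
  replace (Cmod (rising (z + alpha) m) * (/ 2 / Re z * v m))
    with (/ 2 / Re z * (v m * Cmod (rising (z + alpha) m))) by ring.
  apply Rmult_le_compat; try apply Cmod_ge_0; auto.
  rewrite Cmod_div by (apply Re_pos_neq_0, Re_shift_pos; lra).
  apply Rmult_le_compat; try apply Cmod_ge_0.
  + apply Rlt_le, Rinv_0_lt_compat, Cmod_gt_0, Re_pos_neq_0, Re_shift_pos; lra.
  + apply Cmod_centered; auto.
  + apply Rinv_le_contravar; auto; apply Cmod_ge_Re; simpl; fold (Re z); lra.
- evar_last; [apply (is_lim_seq_scal_l _ (/ 2 / Re z)); exact Lv|]; simpl; f_equal; ring.
Qed.

Lemma binet_term_shift (z alpha : C) m : 0 < Re (z + alpha)%C ->
  (binet_term z alpha m - binet_term (z + 1) alpha m)%C =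
  (RtoC (INR m) * binet_poly m alpha / rising (z + alpha) (S m))%C.
Proof.
intros Hw; unfold binet_term.
replace (z + 1 + alpha)%C with (z + alpha + 1)%C by ring.
assert (N := rising_neq_0 (z + alpha) m Hw).
assert (N' := rising_neq_0 (z + alpha) (S m) Hw).
assert (E := rising_shift (z + alpha) m).
assert (M : rising (z + alpha + 1) m <> 0%C).
{ intros M; rewrite M, Cmult_0_r in E; auto. }
assert (W := Re_pos_neq_0 _ Hw).
transitivity (RtoC (INR m) * binet_poly m alpha / ((RtoC (INR m) + (z + alpha)) * rising (z + alpha) m))%C;
  [|rewrite rising_S, (Cmult_comm (rising _ _)); reflexivity].
assert (N1 : (RtoC (INR m) + (z + alpha))%C <> 0%C).
{ intros F; rewrite rising_S, F, Cmult_0_r in N'; auto. }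
rewrite rising_S in E.
assert (E' : rising (z + alpha) m = ((z + alpha) * rising (z + alpha + 1) m / (RtoC (INR m) + (z + alpha)))%C).
{ rewrite <- E; field; auto. }
rewrite E'; field; auto.
Qed.

Lemma binet_series_shift (z alpha F : C) : 0 < Re z -> - Re z < Re alpha ->
  Clim (Csumlt (fun n => binet_term z alpha (S n))) F ->
  Clim (Csumlt (fun n => binet_term (z + 1) alpha (S n))) (F - gudermann z).
Proof.
intros Hz Ha HF; assert (Hw : 0 < Re (z + alpha)%C) by (simpl; fold (Re z) (Re alpha); lra).
assert (E : forall n, Csumlt (fun n => binet_term (z + 1) alpha (S n)) n =
  (Csumlt (fun n => binet_term z alpha (S n)) n - (gudermann z - gudermann_rest z alpha (S n)))%C).
{ induction n as [|n IH].
  - simpl Csumlt; assert (G := gudermann_rest_S z alpha 0 Hz Hw).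
    rewrite gudermann_rest_0 in G by auto; rewrite G; simpl INR; unfold Cdiv; ring.
  - rewrite !Csumlt_S, IH.
    assert (G := gudermann_rest_S z alpha (S n) Hz Hw).
    rewrite <- binet_term_shift in G by auto.
    replace (binet_term (z + 1) alpha (S n)) with
      (binet_term z alpha (S n) - (binet_term z alpha (S n) - binet_term (z + 1) alpha (S n)))%C by ring.
    rewrite <- G; ring. }
apply (Clim_ext _ _ _ (fun n => eq_sym (E n))).
replace (F - gudermann z)%C with (F - (gudermann z - 0))%C by ring.
apply Clim_minus; auto; apply Clim_minus; [apply Clim_const|].
apply (Clim_S (gudermann_rest z alpha)), gudermann_rest_lim; auto.
Qed.

Lemma Cmod_binet_term_shift_le (z alpha : C) N m : 0 < Re (z + alpha)%C ->
  Cmod (binet_term (z + RtoC (INR N)) alpha (S m)) <=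
  Cmod (z + alpha)%C / Cmod (z + alpha + RtoC (INR N))%C * Cmod (binet_term z alpha (S m)).
Proof.
intros Hw; unfold binet_term.
replace (z + RtoC (INR N) + alpha)%C with (z + alpha + RtoC (INR N))%C by ring.
set (w := (z + alpha)%C) in *.
assert (HwN : 0 < Re (w + RtoC (INR N))%C) by (rewrite re_plus, re_RtoC; generalize (pos_INR N); lra).
rewrite !Cmod_div by (apply rising_neq_0; auto).
assert (R : forall n, Cmod (rising w (S n)) / Cmod w <= Cmod (rising (w + RtoC (INR N)) (S n)) / Cmod (w + RtoC (INR N))%C).
{ intros n; rewrite !rising_shift, !Cmod_mult.
  assert (Q : Cmod (rising (w + 1) n) <= Cmod (rising (w + RtoC (INR N) + 1) n)).
  { induction n as [|n IH]; [apply Rle_refl|].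
    rewrite !rising_S, !Cmod_mult; apply Rmult_le_compat; auto; try apply Cmod_ge_0.
    apply Cmod_le_sqr; rewrite !re_plus, !im_plus, !re_RtoC, !im_RtoC.
    generalize (pos_INR n) (pos_INR N); nra. }
  assert (W := Cmod_ge_Re w _ (Rle_refl _)).
  assert (W' := Cmod_ge_Re _ _ (Rle_refl (Re (w + RtoC (INR N))%C))).
  unfold Rdiv; rewrite !(Rmult_comm (Cmod _) (Cmod (rising _ _))), !Rmult_assoc, !Rinv_r by lra; lra. }
specialize (R m).
assert (P := Cmod_rising_pos w (S m) Hw).
assert (P' := Cmod_rising_pos _ (S m) HwN).
assert (W := Cmod_ge_Re w _ (Rle_refl _)).
assert (W' := Cmod_ge_Re _ _ (Rle_refl (Re (w + RtoC (INR N))%C))).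
set (a := Cmod (rising w (S m))) in *; set (b := Cmod (rising (w + RtoC (INR N)) (S m))) in *.
set (p := Cmod w) in *; set (q := Cmod (w + RtoC (INR N))%C) in *.
replace (p / q * (Cmod (binet_poly (S m) alpha) / a))
  with (Cmod (binet_poly (S m) alpha) * / (a / p * q)) by (field; repeat split; lra).
apply Rmult_le_compat_l; [apply Cmod_ge_0|].
apply Rinv_le_contravar.
- apply Rmult_lt_0_compat; [apply Rdiv_lt_0_compat|]; lra.
- apply Rle_trans with (b / q * q); [apply Rmult_le_compat_r; lra|].
  unfold Rdiv; rewrite Rmult_assoc, Rinv_l by lra; lra.
Qed.

Lemma binet_series_gudermann (z alpha F : C) : 0 < Re z -> - Re z < Re alpha ->
  Clim (Csumlt (fun n => binet_term z alpha (S n))) F ->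
  Clim (Csumlt (fun n => gudermann (z + RtoC (INR n)))) F.
Proof.
intros Hz Ha HF; assert (Hw : 0 < Re (z + alpha)%C) by (simpl; fold (Re z) (Re alpha); lra).
assert (S1 : forall N, Clim (Csumlt (fun n => binet_term (z + RtoC (INR N)) alpha (S n)))
   (F - Csumlt (fun n => gudermann (z + RtoC (INR n))) N)).
{ induction N as [|N IH].
  - simpl; replace (z + 0)%C with z by ring; replace (F - 0)%C with F by ring; auto.
  - rewrite S_INR, RtoC_plus, Csumlt_S.
    replace (z + (RtoC (INR N) + 1))%C with (z + RtoC (INR N) + 1)%C by ring.
    replace (F - (Csumlt (fun n => gudermann (z + RtoC (INR n))) N + gudermann (z + RtoC (INR N))))%C
     with (F - Csumlt (fun n => gudermann (z + RtoC (INR n))) N - gudermann (z + RtoC (INR N)))%C by ring.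
    apply binet_series_shift; auto; simpl; fold (Re z); generalize (pos_INR N); lra. }
set (B := Series (fun n => Cmod (binet_term z alpha (S n)))).
assert (EB := ex_series_Cmod_binet_term z alpha Hz Ha).
assert (S2 : forall N, Cmod (F - Csumlt (fun n => gudermann (z + RtoC (INR n))) N)%C <=
   Cmod (z + alpha)%C * B / (Re (z + alpha)%C + INR N)).
{ intros N; apply Rle_trans with (Cmod (z + alpha)%C / Cmod (z + alpha + RtoC (INR N))%C * B).
  - apply Clim_bound with (2 := S1 N).
    unfold B; rewrite <- Series_scal_l.
    apply Cmod_Csumlt_le.
    + intros n; apply Cmod_binet_term_shift_le; auto.
    + apply (ex_series_scal_l (K := R_AbsRing) (V := R_NormedModule)); auto.
  - assert (B0 : 0 <= B).
    { apply Rle_trans with (Cmod (Csumlt (fun n => binet_term z alpha (S n)) 0)); [apply Cmod_ge_0|].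
      apply Cmod_Csumlt_le; auto; intros; apply Rle_refl. }
    assert (Re (z + alpha)%C + INR N <= Cmod (z + alpha + RtoC (INR N))%C)
      by (apply Cmod_ge_Re; rewrite (re_plus (z + alpha)), re_RtoC; lra).
    replace (Cmod (z + alpha)%C / Cmod (z + alpha + RtoC (INR N))%C * B)
      with (Cmod (z + alpha)%C * B * / Cmod (z + alpha + RtoC (INR N))%C) by (unfold Rdiv; ring).
    apply Rmult_le_compat_l.
    + apply Rmult_le_pos; auto; apply Cmod_ge_0.
    + apply Rinv_le_contravar; auto; generalize (pos_INR N); lra. }
apply Clim_le with (fun N => Cmod (z + alpha)%C * B / (Re (z + alpha)%C + INR N)).
- intros N; rewrite <- Cmod_opp; eapply Rle_trans; [|apply S2]; right; f_equal; ring.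
- assert (L : is_lim_seq (fun N => Re (z + alpha)%C + INR N) p_infty).
  { apply is_lim_seq_plus with (Re (z + alpha)%C) p_infty;
      [apply is_lim_seq_const | apply is_lim_seq_INR | reflexivity]. }
  apply is_lim_seq_inv in L; [|discriminate].
  evar_last; [apply (is_lim_seq_scal_l _ (Cmod (z + alpha)%C * B)); exact L|].
  simpl; f_equal; ring.
Qed.

Lemma ex_gudermann_series (z alpha : C) : 0 < Re z -> - Re z < Re alpha ->
  exists F, Clim (Csumlt (fun n => binet_term z alpha (S n))) F /\
    Clim (Csumlt (fun n => gudermann (z + RtoC (INR n)))) F.
Proof.
intros Hz Ha; destruct (ex_Clim_Csumlt _ (ex_series_Cmod_binet_term z alpha Hz Ha)) as [F HF].
exists F; split; auto; apply binet_series_gudermann with alpha; auto.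
Qed.

(** * Exponential, logarithm and Wallis' product *)

Lemma Cexp_plus (u v : C) : Cexp (u + v) = (Cexp u * Cexp v)%C.
Proof.
apply C_eq; unfold Cexp; rewrite re_plus, im_plus, exp_plus, ?cos_plus, ?sin_plus; simpl; ring.
Qed.

Lemma Cexp_RtoC (x : R) : Cexp (RtoC x) = RtoC (exp x).
Proof. apply C_eq; unfold Cexp; simpl; rewrite ?cos_0, ?sin_0; ring. Qed.

Lemma Cmod_Cexp (z : C) : Cmod (Cexp z) = exp (Re z).
Proof.
assert (E := exp_pos (Re z)).
apply Rsqr_inj; [apply Cmod_ge_0 | lra |]; unfold Rsqr; rewrite Cmod_sqr; unfold Cexp; simpl.
generalize (sin2_cos2 (Im z)); unfold Rsqr; fold (Re z) (Im z); intros H.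
transitivity (exp (Re z) * exp (Re z) * (sin (Im z) * sin (Im z) + cos (Im z) * cos (Im z))); [ring|].
rewrite H; ring.
Qed.

Lemma Cexp_neq_0 (z : C) : Cexp z <> 0%C.
Proof. apply Cmod_gt_0; rewrite Cmod_Cexp; apply exp_pos. Qed.

Lemma Cexp_opp (z : C) : Cexp (- z) = (/ Cexp z)%C.
Proof.
assert (N := Cexp_neq_0 z).
assert (E : (Cexp (- z) * Cexp z)%C = 1%C).
{ rewrite <- Cexp_plus; replace (- z + z)%C with (RtoC 0) by ring.
  rewrite Cexp_RtoC, exp_0; reflexivity. }
replace (Cexp (- z)) with (Cexp (- z) * Cexp z * / Cexp z)%C by (field; auto).
rewrite E; ring.
Qed.

Lemma Cexp_Clog (z : C) : 0 < Re z -> Cexp (Clog z) = z.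
Proof.
intros H; assert (P : 0 < Cmod z) by (generalize (Re_le_Cmod z); lra).
assert (Q : sqrt (1 + Rsqr (Im z / Re z)) = Cmod z / Re z).
{ apply sqrt_lem_1.
  - generalize (Rle_0_sqr (Im z / Re z)); lra.
  - apply Rlt_le, Rdiv_lt_0_compat; auto.
  - replace (Cmod z / Re z * (Cmod z / Re z)) with (Cmod z * Cmod z / (Re z * Re z)) by (field; lra).
    rewrite Cmod_sqr; unfold Rsqr; field; lra. }
unfold Cexp, Clog; apply C_eq; simpl; fold (Re z) (Im z);
  rewrite exp_ln, ?cos_atan, ?sin_atan, Q by auto; field; lra.
Qed.

Lemma Clog_RtoC (x : R) : 0 < x -> Clog (RtoC x) = RtoC (ln x).
Proof.
intros H; unfold Clog; rewrite Cmod_R, Rabs_pos_eq by lra; simpl.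
unfold Rdiv; rewrite Rmult_0_l, atan_0; reflexivity.
Qed.

Lemma Cmod_Cexp_minus_1 (w : C) : Cmod (Cexp w - 1)%C <= Cmod w * Rmax 1 (exp (Re w)).
Proof.
assert (I : is_CRInt (fun t => RtoC 1 * w * Cexp (RtoC t * w))%C 0 1 (Cexp w - 1)%C).
{ apply is_CRInt_eq with (Cexp (RtoC 1 * w) - Cexp (RtoC 0 * w))%C.
  - rewrite Cmult_1_l, Cmult_0_l, (Cexp_RtoC 0), exp_0; reflexivity.
  - assert (D : forall t, Cderiv (fun s => RtoC s * w)%C t (RtoC 1 * w)).
    { intros t; eapply Cderiv_eq; [|apply Cderiv_mult; [apply Cderiv_id | apply Cderiv_const]]; cbv beta; ring. }
    apply (is_CRInt_derive (fun t => Cexp (RtoC t * w))); intros t _.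
    + apply (Cderiv_Cexp (fun s => RtoC s * w)%C); auto.
    + apply Ccont_mult; [apply Ccont_const|].
      eapply Cderiv_cont; apply (Cderiv_Cexp (fun s => RtoC s * w)%C); auto. }
revert I; apply is_CRInt01_le; intros t Ht.
rewrite !Cmod_mult, Cmod_1, Rmult_1_l; apply Rmult_le_compat_l; [apply Cmod_ge_0|].
rewrite Cmod_Cexp, re_scal_l.
destruct (Rle_lt_dec 0 (Re w)).
- eapply Rle_trans; [|apply Rmax_r]; apply exp_le_mono; nra.
- eapply Rle_trans; [|apply Rmax_l]; rewrite <- exp_0; apply exp_le_mono; nra.
Qed.

Lemma Clim_Cexp_0 (u : nat -> C) : Clim u 0 -> Clim (fun n => Cexp (u n)) 1.
Proof.
intros H.
assert (H0 : is_lim_seq (fun n => Cmod (u n)) 0).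
{ revert H; apply is_lim_seq_ext; intros n; f_equal; ring. }
apply Clim_le with (fun n => Cmod (u n) * exp (Cmod (u n))).
- intros n; eapply Rle_trans; [apply Cmod_Cexp_minus_1|].
  apply Rmult_le_compat_l; [apply Cmod_ge_0|].
  apply Rmax_lub.
  + rewrite <- exp_0; apply exp_le_mono, Cmod_ge_0.
  + apply exp_le_mono, Re_le_Cmod.
- replace 0 with (0 * exp 0) by ring.
  apply is_lim_seq_mult'; auto.
  apply (is_lim_seq_continuous exp _ 0); auto.
  apply derivable_continuous_pt, derivable_pt_exp.
Qed.

Lemma Clog_add_INR_bound (z : C) n : 0 < Re z -> (1 <= n)%nat ->
  Cmod (Clog (z + RtoC (INR n)) - RtoC (ln (INR n)) - z / RtoC (INR n))%C <=
  Cmod z * Cmod z / (INR n * INR n).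
Proof.
intros Hz Hn; assert (P : 1 <= INR n) by (apply (le_INR 1); auto).
assert (N0 : RtoC (INR n) <> 0%C) by (intros E; apply RtoC_inj in E; lra).
assert (R0 : forall t, 0 <= t -> INR n <= Re (RtoC (INR n) + RtoC t * z)%C).
{ intros t Ht; rewrite re_plus, re_RtoC, re_scal_l; nra. }
assert (N1 : forall t, 0 <= t -> (RtoC (INR n) + RtoC t * z)%C <> 0%C).
{ intros t Ht; apply Re_pos_neq_0; generalize (R0 t Ht); lra. }
set (F := fun t => (Clog (RtoC (INR n) + RtoC t * z) - z / RtoC (INR n) * RtoC t)%C).
assert (D : forall t, Cderiv (fun s => RtoC (INR n) + RtoC s * z)%C t z).
{ intros t; eapply Cderiv_eq; [|apply Cderiv_plus; [apply Cderiv_const |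
   apply Cderiv_mult; [apply Cderiv_id | apply Cderiv_const]]]; cbv beta; ring. }
assert (I : is_CRInt (fun t => z / (RtoC (INR n) + RtoC t * z) - z / RtoC (INR n) * 1)%C 0 1
  (Clog (z + RtoC (INR n)) - RtoC (ln (INR n)) - z / RtoC (INR n))%C).
{ apply is_CRInt_eq with (F 1 - F 0)%C.
  - unfold F; replace (RtoC (INR n) + 1 * z)%C with (z + RtoC (INR n))%C by ring.
    replace (RtoC (INR n) + 0 * z)%C with (RtoC (INR n)) by ring.
    rewrite Clog_RtoC by lra; ring.
  - apply is_CRInt_derive; intros t Ht; rewrite Rmin_left, Rmax_right in Ht by lra.
    + apply Cderiv_minus; [apply (Cderiv_Clog (fun s => RtoC (INR n) + RtoC s * z)%C); auto|].
      * generalize (R0 t (proj1 Ht)); lra.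
      * apply Cderiv_scal, Cderiv_id.
    + apply Ccont_minus; [|apply Ccont_const].
      apply Ccont_div; [apply N1; lra | apply Ccont_const | eapply Cderiv_cont, D]. }
revert I; apply is_CRInt01_le; intros t Ht.
assert (R1 := Cmod_ge_Re _ _ (R0 t (proj1 Ht))).
replace (z / (RtoC (INR n) + RtoC t * z) - z / RtoC (INR n) * 1)%C with
  (- (RtoC t * (z * z) / (RtoC (INR n) * (RtoC (INR n) + RtoC t * z))))%C
  by (field; split; auto; apply N1; lra).
rewrite Cmod_opp, Cmod_div, !Cmod_mult, !Cmod_R, !Rabs_pos_eq; try lra.
- unfold Rdiv; apply Rmult_le_compat.
  + apply Rmult_le_pos; [lra|]; apply Rmult_le_pos; apply Cmod_ge_0.
  + apply Rlt_le, Rinv_0_lt_compat; apply Rmult_lt_0_compat; lra.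
  + generalize (Rmult_le_pos _ _ (Cmod_ge_0 z) (Cmod_ge_0 z)); nra.
  + apply Rinv_le_contravar; nra.
- apply Cmod_gt_0; rewrite Cmod_mult, Cmod_R, Rabs_pos_eq by lra; apply Rmult_lt_0_compat; lra.
Qed.

Lemma is_lim_seq_inv_S c : is_lim_seq (fun n => c / INR (S n)) 0.
Proof.
assert (L : is_lim_seq (fun n => INR (S n)) p_infty)
  by (apply (is_lim_seq_incr_1 INR), is_lim_seq_INR).
apply is_lim_seq_inv in L; [|discriminate].
evar_last; [apply (is_lim_seq_scal_l _ c); exact L|]; simpl; f_equal; ring.
Qed.

Lemma Clog_add_INR_lim (z : C) : 0 < Re z ->
  Clim (fun n => (z + RtoC (INR (S n)) + 1 / 2) *
    (Clog (z + RtoC (INR (S n))) - RtoC (ln (INR (S n)))) - z)%C 0.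
Proof.
intros Hz; apply Clim_le with (fun n => ((Cmod z + 1) * Cmod z + (Cmod z + 2) * (Cmod z * Cmod z)) / INR (S n));
  [|apply is_lim_seq_inv_S].
intros n; set (N := INR (S n)).
assert (B := Clog_add_INR_bound z (S n) Hz ltac:(lia)); fold N in B.
assert (N1 : 1 <= N) by (apply (le_INR 1); lia).
assert (N0 : RtoC N <> 0%C) by (apply RtoC_INR_neq_0).
set (d := (Clog (z + RtoC N) - RtoC (ln N) - z / RtoC N)%C) in *.
replace ((z + RtoC N + 1 / 2) * (Clog (z + RtoC N) - RtoC (ln N)) - z - 0)%C
  with ((z + 1 / 2) * (z / RtoC N) + (z + 1 / 2 + RtoC N) * d)%C
  by (unfold d; field; auto).
assert (z0 := Cmod_ge_0 z).
assert (h : Cmod (z + 1 / 2)%C <= Cmod z + 1).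
{ eapply Rle_trans; [apply Cmod_triangle|]; apply Rplus_le_compat_l.
  replace (1 / 2)%C with (RtoC (/ 2)) by (rewrite RtoC_inv by lra; field; apply (RtoC_INR_neq_0 1)).
  rewrite Cmod_R, Rabs_pos_eq; lra. }
eapply Rle_trans; [apply Cmod_triangle|].
rewrite !Cmod_mult, Cmod_div, (Cmod_R N), (Rabs_pos_eq N) by (auto; lra).
assert (i0 : 0 < / N) by (apply Rinv_0_lt_compat; lra).
apply Rle_trans with ((Cmod z + 1) * (Cmod z / N) + (Cmod z + 2) * N * (Cmod z * Cmod z / (N * N))).
- apply Rplus_le_compat.
  + apply Rmult_le_compat_r; auto; apply Rmult_le_pos; lra.
  + apply Rmult_le_compat; auto; try apply Cmod_ge_0.
    eapply Rle_trans; [apply Cmod_triangle|].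
    rewrite (Cmod_R N), (Rabs_pos_eq N) by lra; nra.
- right; field; lra.
Qed.

Definition wallis_int (n : nat) : R := RInt (fun t => sin t ^ n) 0 (PI / 2).

Lemma continuous_sin_pow n t : continuous (fun t => sin t ^ n) t.
Proof. apply (ex_derive_continuous (fun t => sin t ^ n)); auto_derive; auto. Qed.

Lemma ex_RInt_sin_pow n : ex_RInt (fun t => sin t ^ n) 0 (PI / 2).
Proof.
apply (ex_RInt_continuous (V := R_CompleteNormedModule)); intros t _; apply continuous_sin_pow.
Qed.

Lemma wallis_int_0 : wallis_int 0 = PI / 2.
Proof.
unfold wallis_int; simpl; rewrite RInt_const; unfold scal; simpl; unfold mult; simpl; ring.
Qed.

Lemma wallis_int_1 : wallis_int 1 = 1.
Proof.
apply is_RInt_unique.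
evar_last.
- apply (is_RInt_derive (V := R_CompleteNormedModule) (fun t => - cos t) (fun t => sin t ^ 1));
    intros t _.
  + auto_derive; auto; ring.
  + apply (continuous_sin_pow 1).
- rewrite cos_PI2, cos_0; unfold minus, plus, opp; simpl; ring.
Qed.

Lemma wallis_int_rec n : INR (S (S n)) * wallis_int (S (S n)) = INR (S n) * wallis_int n.
Proof.
assert (A := RInt_correct (V := R_CompleteNormedModule) _ _ _ (ex_RInt_sin_pow n)).
assert (B := RInt_correct (V := R_CompleteNormedModule) _ _ _ (ex_RInt_sin_pow (S (S n)))).
assert (D := is_RInt_minus (V := R_NormedModule) _ _ _ _ _ _
  (is_RInt_scal (V := R_NormedModule) _ _ _ (INR (S (S n))) _ B)
  (is_RInt_scal (V := R_NormedModule) _ _ _ (INR (S n)) _ A)).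
assert (E : is_RInt (fun t => minus (scal (INR (S (S n))) (sin t ^ S (S n))) (scal (INR (S n)) (sin t ^ n))) 0 (PI / 2)
  (minus (- cos (PI / 2) * sin (PI / 2) ^ S n) (- cos 0 * sin 0 ^ S n))).
{ apply (is_RInt_derive (V := R_CompleteNormedModule) (fun t => - cos t * sin t ^ S n)); intros t _.
  - auto_derive; auto.
    unfold minus, plus, opp, scal; simpl; unfold mult; simpl.
    replace (match n with O => 1 | S _ => INR n + 1 end) with (INR n + 1) by (destruct n; simpl; ring).
    assert (C2 : cos t * cos t = 1 - sin t * sin t) by (generalize (sin2_cos2 t); unfold Rsqr; lra).
    transitivity (sin t * (sin t * sin t ^ n) - (INR n + 1) * (cos t * cos t) * sin t ^ n); [ring|].
    rewrite C2; ring.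
  - apply (ex_derive_continuous (fun t => minus (scal (INR (S (S n))) (sin t ^ S (S n))) (scal (INR (S n)) (sin t ^ n)))).
    unfold minus, plus, opp, scal; simpl; unfold mult; simpl; auto_derive; auto. }
apply (is_RInt_unique (V := R_CompleteNormedModule)) in D.
apply (is_RInt_unique (V := R_CompleteNormedModule)) in E.
apply (eq_trans (eq_sym D)) in E; clear D.
rewrite cos_PI2, sin_0, pow_i in E by lia.
unfold minus, plus, opp, scal in E; simpl in E; unfold mult in E; simpl in E.
unfold wallis_int; simpl in *; lra.
Qed.

Lemma wallis_int_prod n : INR (S n) * (wallis_int n * wallis_int (S n)) = PI / 2.
Proof.
induction n as [|n IH].
- rewrite wallis_int_0, wallis_int_1; simpl; lra.
- rewrite <- IH; transitivity (wallis_int (S n) * (INR (S (S n)) * wallis_int (S (S n)))); [ring|].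
  rewrite wallis_int_rec; ring.
Qed.

Lemma wallis_int_decr n : 0 <= wallis_int (S n) <= wallis_int n.
Proof.
assert (P : 0 <= PI / 2) by (generalize PI_RGT_0; lra).
assert (S : forall t, 0 < t < PI / 2 -> 0 <= sin t <= 1).
{ intros t Ht; split; [apply sin_ge_0; lra | apply SIN_bound]. }
split.
- apply RInt_ge_0; auto; [apply ex_RInt_sin_pow|].
  intros t Ht; apply pow_le, S; auto.
- apply RInt_le; auto; try apply ex_RInt_sin_pow.
  intros t Ht; simpl; assert (Q := pow_le (sin t) n (proj1 (S t Ht))).
  generalize (S t Ht); nra.
Qed.

Lemma wallis_int_pos n : 0 < wallis_int n.
Proof.
destruct (wallis_int_decr n) as [H1 H2].
destruct (Rle_lt_or_eq_dec 0 (wallis_int n)) as [H | H]; auto; try lra.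
generalize (wallis_int_prod n) PI_RGT_0; rewrite <- H; lra.
Qed.

Lemma wallis_int_even n :
  wallis_int (2 * n) * (2 ^ (2 * n) * (INR (fact n) * INR (fact n))) = PI / 2 * INR (fact (2 * n)).
Proof.
induction n as [|n IH].
- change (2 * 0)%nat with O; rewrite wallis_int_0; simpl; ring.
- replace (2 * S n)%nat with (S (S (2 * n))) by lia.
  assert (R := wallis_int_rec (2 * n)).
  rewrite !fact_simpl, !mult_INR; change (2 ^ S (S (2 * n))) with (2 * (2 * 2 ^ (2 * n))).
  assert (E : INR (S (S (2 * n))) = 2 * INR (S n)).
  { rewrite <- (mult_INR 2); f_equal; lia. }
  rewrite E in *.
  transitivity (2 * INR (S n) * (2 * INR (S n) * wallis_int (S (S (2 * n)))) *
    (2 ^ (2 * n) * (INR (fact n) * INR (fact n)))); [ring|].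
  rewrite R.
  transitivity (2 * INR (S n) * INR (S (2 * n)) *
    (wallis_int (2 * n) * (2 ^ (2 * n) * (INR (fact n) * INR (fact n))))); [ring|].
  rewrite IH; ring.
Qed.

Lemma INR_fact_pos n : 0 < INR (fact n).
Proof. apply lt_0_INR, lt_O_fact. Qed.

Lemma wallis_ln :
  is_lim_seq (fun k => 2 * ln (INR (fact (S k))) + 2 * INR (S k) * ln 2 -
    ln (INR (fact (2 * S k))) - / 2 * ln (INR (S k))) (/ 2 * ln PI).
Proof.
assert (P0 := PI_RGT_0).
apply is_lim_seq_le_le with (fun _ => / 2 * ln PI) (fun k => / 2 * ln PI + (/ 4) / INR (S k)).
2: apply is_lim_seq_const.
2: { evar_last; [apply is_lim_seq_plus'; [apply is_lim_seq_const | apply is_lim_seq_inv_S]|].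
     f_equal; ring. }
intros k; set (n := S k).
set (W := wallis_int (2 * n)).
assert (W0 : 0 < W) by apply wallis_int_pos.
assert (f0 := INR_fact_pos n). assert (g0 := INR_fact_pos (2 * n)).
assert (n0 : 0 < INR n) by (apply lt_0_INR; unfold n; lia).
assert (E : 2 * ln (INR (fact n)) + 2 * INR n * ln 2 - ln (INR (fact (2 * n))) = ln (PI / 2) - ln W).
{ assert (H := f_equal ln (wallis_int_even n)); fold W in H.
  assert (T : 0 < 2 ^ (2 * n)) by (apply pow_lt; lra).
  assert (ff : 0 < INR (fact n) * INR (fact n)) by (apply Rmult_lt_0_compat; auto).
  assert (Tf : 0 < 2 ^ (2 * n) * (INR (fact n) * INR (fact n))) by (apply Rmult_lt_0_compat; auto).
  rewrite (ln_mult W), (ln_mult (2 ^ _)), (ln_mult (INR (fact n))), (ln_mult (PI / 2)) in H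
    by (auto; lra).
  rewrite ln_pow, mult_INR in H by lra; simpl (INR 2) in H; lra. }
rewrite E.
assert (U : INR (2 * n) * (W * W) <= PI / 2).
{ replace (2 * n)%nat with (S (2 * n - 1)) by (unfold n; lia).
  rewrite <- (wallis_int_prod (2 * n - 1)).
  apply Rmult_le_compat_l; [apply pos_INR|].
  replace (S (2 * n - 1)) with (2 * n)%nat by (unfold n; lia); fold W.
  apply Rmult_le_compat_r; [lra|].
  unfold W; replace (2 * n)%nat with (S (2 * n - 1)) at 1 by (unfold n; lia).
  apply wallis_int_decr. }
assert (L : PI / 2 <= INR (S (2 * n)) * (W * W)).
{ rewrite <- (wallis_int_prod (2 * n)); fold W.
  apply Rmult_le_compat_l; [apply pos_INR|].
  apply Rmult_le_compat_l; [lra|]; apply wallis_int_decr. }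
assert (e2 : INR (2 * n) = 2 * INR n) by (rewrite mult_INR; reflexivity).
rewrite S_INR, e2 in L; rewrite e2 in U.
apply ln_le in U; [|apply Rmult_lt_0_compat; nra].
apply ln_le in L; [|lra].
rewrite !ln_mult in U by nra.
rewrite !ln_mult in L by nra.
assert (l2 : ln (PI / 2) = ln PI - ln 2) by (apply ln_div; lra).
assert (B : ln (2 * INR n + 1) <= ln 2 + ln (INR n) + / 2 / INR n).
{ rewrite <- ln_mult, <- (ln_exp (/ 2 / INR n)), <- ln_mult by (try apply exp_pos; lra).
  apply ln_le; [lra|].
  apply Rle_trans with (2 * INR n * (1 + / 2 / INR n)).
  - right; field; lra.
  - apply Rmult_le_compat_l; [lra|]; apply exp_ineq1_le. }
replace (/ 2 / INR n) with (2 * (/ 4 / INR n)) in B by (field; lra).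
fold n; lra.
Qed.

(** * Stirling's formula *)

Definition gudermann_sum (z : C) : nat -> C := Csumlt (fun n => gudermann (z + RtoC (INR n))%C).

Definition mu (z : C) : C :=
  (real (Lim_seq (fun n => Re (gudermann_sum z n))),
   real (Lim_seq (fun n => Im (gudermann_sum z n)))).

Lemma Clim_Lim_seq (u : nat -> C) (l : C) : Clim u l ->
  l = (real (Lim_seq (fun n => Re (u n))), real (Lim_seq (fun n => Im (u n)))).
Proof.
intros H.
assert (A : forall f : C -> R, (forall a b, Rabs (f a - f b) <= Cmod (a - b)%C) ->
  Lim_seq (fun n => f (u n)) = f l).
{ intros f Hf; apply is_lim_seq_unique.
  apply is_lim_seq_ext with (fun n => (f (u n) - f l) + f l); [intros; ring|].
  evar_last; [apply is_lim_seq_plus' with (l1 := 0) (l2 := f l); [|apply is_lim_seq_const] | f_equal; ring].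
  apply is_lim_seq_abs_0, is_lim_seq_le_le with (fun _ => 0) (fun n => Cmod (u n - l)%C); auto.
  - intros n; split; [apply Rabs_pos | apply Hf].
  - apply is_lim_seq_const. }
rewrite (A Re), (A Im).
- destruct l; reflexivity.
- intros a b; apply (Im_le_Cmod (a - b)%C).
- intros a b; apply (re_le_Cmod (a - b)%C).
Qed.

Lemma mu_lim (z : C) : 0 < Re z -> Clim (gudermann_sum z) (mu z).
Proof.
intros Hz; destruct (ex_gudermann_series z 0) as (F & _ & HF); auto.
{ simpl; lra. }
unfold mu; rewrite <- (Clim_Lim_seq _ F); auto.
Qed.

Lemma mu_shift (z : C) : 0 < Re z -> mu (z + 1) = (mu z - gudermann z)%C.
Proof.
intros Hz; apply (Clim_unique (gudermann_sum (z + 1))).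
- apply mu_lim; simpl; fold (Re z); lra.
- apply (Clim_ext (fun n => gudermann_sum z (S n) - gudermann z)%C).
  + intros n; unfold gudermann_sum; rewrite Csumlt_shift.
    rewrite (Csumlt_ext (fun k => gudermann (z + 1 + RtoC (INR k))%C)
      (fun k => gudermann (z + RtoC (INR (S k)))%C)).
    * change (INR 0) with 0; replace (z + 0)%C with z by ring; ring.
    * intros k _; f_equal; rewrite S_INR, RtoC_plus; ring.
  + apply Clim_minus; [|apply Clim_const].
    apply (Clim_S (gudermann_sum z)), mu_lim; auto.
Qed.

Lemma mu_add_INR_lim (z : C) : 0 < Re z -> Clim (fun n => mu (z + RtoC (INR n))%C) 0.
Proof.
intros Hz; apply (Clim_ext (fun n => mu z - gudermann_sum z n)%C).
- induction n as [|n IH].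
  + simpl; unfold gudermann_sum; simpl; replace (z + 0)%C with z by ring; ring.
  + rewrite S_INR, RtoC_plus.
    replace (z + (RtoC (INR n) + 1))%C with (z + RtoC (INR n) + 1)%C by ring.
    rewrite mu_shift, <- IH.
    * unfold gudermann_sum; rewrite Csumlt_S; ring.
    * rewrite re_plus, re_RtoC; generalize (pos_INR n); lra.
- replace (RtoC 0) with (mu z - mu z)%C by ring.
  apply Clim_minus; [apply Clim_const | apply mu_lim; auto].
Qed.

Definition stirling_log (z : C) : C :=
  (mu z + (z - 1 / 2) * Clog z - z + 1 / 2 * RtoC (ln (2 * PI)))%C.

Lemma stirling_log_shift (z : C) : 0 < Re z ->
  stirling_log (z + 1) = (stirling_log z + Clog z)%C.
Proof.
intros Hz; unfold stirling_log; rewrite mu_shift by auto; unfold gudermann; field.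
Qed.

Lemma Im_gudermann_RtoC (x : R) : 0 < x -> Im (gudermann (RtoC x)) = 0.
Proof.
intros H; unfold gudermann.
replace (RtoC x + 1)%C with (RtoC (x + 1)) by (rewrite RtoC_plus; reflexivity).
rewrite !Clog_RtoC by lra.
replace (RtoC x + 1 / 2)%C with (RtoC (x + / 2))
  by (rewrite RtoC_plus, RtoC_inv by lra; field; apply (RtoC_INR_neq_0 1)).
rewrite <- RtoC_minus, <- RtoC_mult, <- RtoC_minus; reflexivity.
Qed.

Lemma Im_mu_RtoC (x : R) : 0 < x -> Im (mu (RtoC x)) = 0.
Proof.
intros H; unfold mu; simpl.
rewrite (Lim_seq_ext _ (fun _ => 0)); [rewrite Lim_seq_const; reflexivity|].
intros n; unfold gudermann_sum; induction n as [|n IH]; [reflexivity|].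
rewrite Csumlt_S, im_plus, IH, <- RtoC_plus, Im_gudermann_RtoC; [ring|].
generalize (pos_INR n); lra.
Qed.

Lemma stirling_log_RtoC (x : R) : 0 < x ->
  stirling_log (RtoC x) = RtoC (Re (mu (RtoC x)) + (x - / 2) * ln x - x + / 2 * ln (2 * PI)).
Proof.
intros H; unfold stirling_log; rewrite Clog_RtoC by auto.
replace (mu (RtoC x)) with (RtoC (Re (mu (RtoC x)))) at 1
  by (apply C_eq; [|rewrite Im_mu_RtoC by auto]; reflexivity).
rewrite !RtoC_plus, !RtoC_minus, RtoC_plus, !RtoC_mult, RtoC_minus, RtoC_inv by lra.
field; apply (RtoC_INR_neq_0 1).
Qed.

Lemma stirling_log_INR n :
  stirling_log (RtoC (INR (S n))) = (stirling_log 1 + RtoC (ln (INR (fact n))))%C.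
Proof.
induction n as [|n IH].
- simpl; rewrite ln_1; ring.
- rewrite S_INR, RtoC_plus, stirling_log_shift by (apply lt_0_INR; lia).
  assert (0 < INR (S n)) by (apply lt_0_INR; lia).
  rewrite IH, Clog_RtoC by auto.
  rewrite fact_simpl, mult_INR, ln_mult by (auto; apply INR_fact_pos).
  rewrite RtoC_plus; ring.
Qed.

Lemma stirling_log_1 : stirling_log 1 = 0%C.
Proof.
set (m := fun n => Re (mu (RtoC (INR n)))).
assert (Lm : is_lim_seq m 0).
{ apply is_lim_seq_incr_1, is_lim_seq_abs_0.
  assert (L := mu_add_INR_lim 1 ltac:(simpl; lra)).
  apply is_lim_seq_le_le with (fun _ => 0) (fun n => Cmod (mu (1 + RtoC (INR n)) - 0)%C); auto.
  - intros n; split; [apply Rabs_pos|].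
    unfold m; rewrite S_INR, RtoC_plus, Cplus_comm.
    replace (mu (1 + RtoC (INR n)) - 0)%C with (mu (1 + RtoC (INR n))) by ring.
    apply re_le_Cmod.
  - apply is_lim_seq_const. }
set (kappa := Re (stirling_log 1)).
assert (E1 : stirling_log 1 = RtoC kappa) by (unfold kappa; rewrite stirling_log_RtoC by lra; reflexivity).
assert (P0 := PI_RGT_0).
assert (F : forall n, (1 <= n)%nat ->
  ln (INR (fact n)) = m n + (INR n + / 2) * ln (INR n) - INR n + / 2 * ln (2 * PI) - kappa).
{ intros [|n] Hn; [lia|].
  assert (0 < INR (S n)) by (apply lt_0_INR; lia).
  assert (E := stirling_log_INR n); rewrite stirling_log_RtoC, E1, <- RtoC_plus in E by auto.
  apply RtoC_inj in E; rewrite fact_simpl, mult_INR, ln_mult by (auto; apply INR_fact_pos).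
  unfold m; lra. }
assert (Lm1 : is_lim_seq (fun k => m (S k)) 0) by (apply (is_lim_seq_incr_1 m); auto).
assert (Lm2 : is_lim_seq (fun k => m (2 * S k)%nat) 0).
{ apply (is_lim_seq_subseq m 0 (fun k => (2 * S k)%nat)); auto.
  apply eventually_subseq; intros; lia. }
assert (L : is_lim_seq (fun k => 2 * m (S k) - m (2 * S k)%nat + (/ 2 * ln PI - kappa)) (2 * 0 - 0 + (/ 2 * ln PI - kappa))).
{ apply is_lim_seq_plus'; [|apply is_lim_seq_const].
  apply is_lim_seq_minus'; auto.
  apply is_lim_seq_mult'; auto; apply is_lim_seq_const. }
assert (W := wallis_ln).
apply is_lim_seq_ext with (v := fun k => 2 * m (S k) - m (2 * S k)%nat + (/ 2 * ln PI - kappa)) in W.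
- apply is_lim_seq_unique in W; apply is_lim_seq_unique in L; rewrite W in L.
  injection L; intros Q; rewrite E1; f_equal; lra.
- intros k; rewrite !F by lia.
  assert (0 < INR (S k)) by (apply lt_0_INR; lia).
  rewrite (mult_INR 2), (ln_mult (INR 2)), (ln_mult 2) by (simpl INR in *; lra).
  simpl (INR 2); replace (1 + 1) with 2 by ring; lra.
Qed.

Lemma Cexp_stirling_log_add (z : C) n : 0 < Re z ->
  Cexp (stirling_log (z + RtoC (INR n))) = (rising z n * Cexp (stirling_log z))%C.
Proof.
intros Hz; induction n as [|n IH].
- unfold rising; simpl; replace (z + 0)%C with z by ring; ring.
- rewrite S_INR, RtoC_plus.
  replace (z + (RtoC (INR n) + 1))%C with (z + RtoC (INR n) + 1)%C by ring.
  assert (P : 0 < Re (z + RtoC (INR n))%C) by (rewrite re_plus, re_RtoC; generalize (pos_INR n); lra).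
  rewrite stirling_log_shift, Cexp_plus, IH, Cexp_Clog, rising_S by auto; ring.
Qed.

Lemma Euler_product_lim (z : C) : 0 < Re z ->
  Clim (fun n => Cexp (z * RtoC (ln (INR (S n)))) * RtoC (INR (fact (S n))) / rising z (S (S n)))%C
    (Cexp (stirling_log z)).
Proof.
intros Hz.
set (e := fun n => (mu (1 + RtoC (INR n)) - mu (z + RtoC (INR (S n))) -
  ((z + RtoC (INR (S n)) + 1 / 2) * (Clog (z + RtoC (INR (S n))) - RtoC (ln (INR (S n)))) - z))%C).
assert (Le : Clim e 0).
{ replace (RtoC 0) with (0 - 0 - 0)%C by ring.
  apply Clim_minus; [apply Clim_minus|].
  - apply mu_add_INR_lim; simpl; lra.
  - exact (proj1 (Clim_S (fun n => mu (z + RtoC (INR n)))%C 0) (mu_add_INR_lim z Hz)).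
  - apply Clog_add_INR_lim; auto. }
apply Clim_Cexp_0 in Le.
apply (Clim_ext (fun n => Cexp (stirling_log z) * Cexp (e n))%C).
- intros n.
  assert (P : 0 < INR (S n)) by (apply lt_0_INR; lia).
  assert (Q : 0 < Re (z + RtoC (INR (S n)))%C) by (rewrite re_plus, re_RtoC; lra).
  assert (f1 : RtoC (INR (fact (S n))) = Cexp (stirling_log (RtoC (INR (S n)) + 1))).
  { replace (RtoC (INR (S n)) + 1)%C with (RtoC (INR (S (S n)))) by (rewrite (S_INR (S n)), RtoC_plus; reflexivity).
    rewrite stirling_log_INR, stirling_log_1, Cplus_0_l, Cexp_RtoC, exp_ln; auto.
    apply INR_fact_pos. }
  rewrite f1; assert (G := Cexp_stirling_log_add z (S (S n)) Hz).
  assert (N := rising_neq_0 z (S (S n)) Hz).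
  assert (N' := Cexp_neq_0 (stirling_log z)).
  assert (G' : rising z (S (S n)) = (Cexp (stirling_log (z + RtoC (INR (S (S n))))) / Cexp (stirling_log z))%C)
    by (rewrite G; field; auto).
  rewrite G'; transitivity (Cexp (stirling_log z) * (Cexp (z * RtoC (ln (INR (S n)))) *
    Cexp (stirling_log (RtoC (INR (S n)) + 1)) * / Cexp (stirling_log (z + RtoC (INR (S (S n)))))))%C.
  2: field; split; apply Cexp_neq_0.
  rewrite <- Cexp_opp, <- !Cexp_plus; f_equal; f_equal.
  replace (z + RtoC (INR (S (S n))))%C with (z + RtoC (INR (S n)) + 1)%C
    by (rewrite (S_INR (S n)), RtoC_plus; ring).
  rewrite !stirling_log_shift by auto.
  unfold e, stirling_log; rewrite Clog_RtoC by auto.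
  replace (1 + RtoC (INR n))%C with (RtoC (INR (S n))) by (rewrite S_INR, RtoC_plus; ring).
  field; apply (RtoC_INR_neq_0 1).
- generalize (Clim_scal (Cexp (stirling_log z)) _ _ Le); rewrite Cmult_1_r; auto.
Qed.

(** * Euler's integral *)

Ltac Req := match goal with |- @eq _ ?u ?v => change (@eq R u v) end.

Notation euler_domain := (filter_prod (at_right 0) (Rbar_locally p_infty)).

Lemma euler_domain_pos : euler_domain (fun ab => 0 < fst ab < 1 /\ 1 < snd ab).
Proof.
exists (fun a => 0 < a < 1) (fun b => 1 < b).
- exists (mkposreal 1 Rlt_0_1); intros y Hy y0; split; auto.
  unfold ball in Hy; simpl in Hy; unfold AbsRing_ball, abs, minus, plus, opp in Hy; simpl in Hy.
  apply Rabs_def2 in Hy; lra.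
- exists 1; auto.
- simpl; auto.
Qed.

Lemma power_exp_at_right x eta : 0 < x -> 0 < eta ->
  at_right 0 (fun t => exp (x * ln t - t) <= eta).
Proof.
intros Hx He; exists (mkposreal _ (exp_pos (ln eta / x))); intros y Hy y0.
unfold ball in Hy; simpl in Hy; unfold AbsRing_ball, abs, minus, plus, opp in Hy; simpl in Hy.
apply Rabs_def2 in Hy; rewrite <- (exp_ln eta) by auto; apply exp_le_mono.
assert (L : ln y < ln eta / x).
{ rewrite <- (ln_exp (ln eta / x)); apply ln_increasing; lra. }
apply (Rmult_lt_compat_l x) in L; auto.
replace (x * (ln eta / x)) with (ln eta) in L by (field; lra); lra.
Qed.

Lemma power_exp_p_infty x eta : 0 < x -> 0 < eta ->
  Rbar_locally p_infty (fun t => exp (x * ln t - t) <= eta).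
Proof.
intros Hx He.
assert (L := is_lim_div_ln_p); apply is_lim_spec in L; unfold is_lim' in L.
assert (P : 0 < / (2 * x)) by (apply Rinv_0_lt_compat; lra).
destruct (L (mkposreal _ P)) as [M HM]; simpl in HM.
exists (Rmax M (Rmax 0 (- 2 * ln eta))); intros t Ht.
assert (T1 := Rle_lt_trans _ _ _ (Rmax_l _ _) Ht).
assert (T2 := Rle_lt_trans _ _ _ (Rmax_r _ _) Ht).
assert (T3 := Rle_lt_trans _ _ _ (Rmax_l _ _) T2).
assert (T4 := Rle_lt_trans _ _ _ (Rmax_r _ _) T2).
specialize (HM t T1); apply Rabs_def2 in HM; destruct HM as [HM _].
rewrite <- (exp_ln eta) by auto; apply exp_le_mono.
assert (Q : x * ln t <= t / 2).
{ assert (R : ln t / t * (x * t) <= / (2 * x) * (x * t)) by (apply Rmult_le_compat_r; nra).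
  replace (ln t / t * (x * t)) with (x * ln t) in R by (field; lra).
  replace (/ (2 * x) * (x * t)) with (t / 2) in R by (field; lra); lra. }
lra.
Qed.

Definition gamma_integrand (z : C) (t : R) : C :=
  (Cexp ((z - 1) * RtoC (ln t)) * RtoC (exp (- t)))%C.

Lemma gamma_integrand_S (z : C) t : 0 < t ->
  gamma_integrand (z + 1) t = (RtoC t * gamma_integrand z t)%C.
Proof.
intros Ht; unfold gamma_integrand.
replace ((z + 1 - 1) * RtoC (ln t))%C with (RtoC (ln t) + (z - 1) * RtoC (ln t))%C by ring.
rewrite Cexp_plus, Cexp_RtoC, exp_ln by auto; ring.
Qed.

Lemma Cmod_gamma_integrand (z : C) t : Cmod (gamma_integrand (z + 1) t) = exp (Re z * ln t - t).
Proof.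
unfold gamma_integrand; replace (z + 1 - 1)%C with z by ring.
rewrite Cmod_mult, Cmod_Cexp, Cmod_R, Rabs_pos_eq by apply Rlt_le, exp_pos.
rewrite <- exp_plus, re_scal_r; reflexivity.
Qed.

Lemma Cderiv_gamma_integrand (z : C) t : 0 < t ->
  Cderiv (gamma_integrand z) t
    ((z - 1) / RtoC t * gamma_integrand z t - gamma_integrand z t).
Proof.
intros Ht; unfold gamma_integrand.
assert (D1 : Cderiv (fun s => (z - 1) * RtoC (ln s))%C t ((z - 1) * RtoC (/ t))).
{ apply Cderiv_scal, Cderiv_RtoC; apply is_derive_Reals, derivable_pt_lim_ln; auto. }
assert (D2 : Cderiv (fun s => RtoC (exp (- s))) t (RtoC (- exp (- t)))).
{ apply Cderiv_RtoC; auto_derive; auto; ring. }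
eapply Cderiv_eq; [|exact (Cderiv_mult _ _ _ _ _ (Cderiv_Cexp _ _ _ D1) D2)]; cbv beta.
rewrite RtoC_inv, RtoC_opp by lra; unfold Cdiv; ring.
Qed.

Lemma Ccont_gamma_integrand (z : C) t : 0 < t -> Ccont (gamma_integrand z) t.
Proof. intros Ht; eapply Cderiv_cont, Cderiv_gamma_integrand; auto. Qed.

Lemma is_CRInt_gamma_parts (z l : C) a b : 0 < a -> a <= b ->
  is_CRInt (gamma_integrand (z + 1)) a b l ->
  is_CRInt (fun t => z * gamma_integrand z t)%C a b
    (l + (gamma_integrand (z + 1) b - gamma_integrand (z + 1) a))%C.
Proof.
intros Ha Hab H.
assert (I : is_CRInt (fun t => z * gamma_integrand z t - gamma_integrand (z + 1) t)%C a b
  (gamma_integrand (z + 1) b - gamma_integrand (z + 1) a)%C).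
{ apply is_CRInt_derive; intros t Ht; rewrite Rmin_left in Ht by auto.
  - eapply Cderiv_eq; [|apply Cderiv_gamma_integrand; lra].
    rewrite gamma_integrand_S by lra; field; intros E; apply RtoC_inj in E; lra.
  - apply Ccont_minus; [apply Ccont_mult; [apply Ccont_const|]|]; apply Ccont_gamma_integrand; lra. }
generalize (is_CRInt_plus _ _ _ _ _ _ H I); apply is_CRInt_ext; intros t _; ring.
Qed.

(* Approximate value, up to an error [d], of the integral truncated to [[a, b]], for
   [a] near [0] and [b] near infinity: it makes the recurrence available before
   convergence is known. *)
Definition gamma_near (z l : C) (d : R) : Prop :=
  forall eta, 0 < eta -> euler_domain (fun ab => exists v : C,
    is_CRInt (gamma_integrand z) (fst ab) (snd ab) v /\ Cmod (v - l)%C <= d + eta).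

Lemma gamma_near_div (z l : C) d : 0 < Re z ->
  gamma_near (z + 1) l d -> gamma_near z (l / z) (d / Cmod z).
Proof.
intros Hz H eta He.
assert (Z : z <> 0%C) by (apply Re_pos_neq_0; auto).
assert (Zp : 0 < Cmod z) by (apply Cmod_gt_0; auto).
assert (P : 0 < eta * Cmod z / 3) by (apply Rdiv_lt_0_compat; [apply Rmult_lt_0_compat|]; lra).
assert (B : euler_domain (fun ab => Cmod (gamma_integrand (z + 1) (fst ab)) <= eta * Cmod z / 3 /\
  Cmod (gamma_integrand (z + 1) (snd ab)) <= eta * Cmod z / 3)).
{ exists (fun t => exp (Re z * ln t - t) <= eta * Cmod z / 3) (fun t => exp (Re z * ln t - t) <= eta * Cmod z / 3).
  - apply power_exp_at_right; auto.
  - apply power_exp_p_infty; auto.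
  - intros a b; simpl; rewrite !Cmod_gamma_integrand; auto. }
generalize (filter_and _ _ euler_domain_pos (filter_and _ _ B (H _ P))); apply filter_imp.
intros [a b]; simpl; intros ([Ha Hb] & [Ba Bb] & v & Iv & Hv).
exists (/ z * (v + (gamma_integrand (z + 1) b - gamma_integrand (z + 1) a)))%C; split.
- eapply is_CRInt_ext; [|apply is_CRInt_scal, is_CRInt_gamma_parts; [| |exact Iv]; lra].
  intros t _; cbv beta; field; auto.
- replace (/ z * (v + (gamma_integrand (z + 1) b - gamma_integrand (z + 1) a)) - l / z)%C
    with (((v - l) + (gamma_integrand (z + 1) b - gamma_integrand (z + 1) a)) / z)%C by (field; auto).
  rewrite Cmod_div by auto.
  replace (d / Cmod z + eta) with ((d + eta * Cmod z / 3 + (eta * Cmod z / 3 + eta * Cmod z / 3)) / Cmod z)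
    by (field; lra).
  apply Rmult_le_compat_r; [apply Rlt_le, Rinv_0_lt_compat; auto|].
  eapply Rle_trans; [apply Cmod_triangle|]; apply Rplus_le_compat; auto.
  eapply Rle_trans; [apply Cmod_triangle|]; rewrite Cmod_opp; lra.
Qed.

Lemma gamma_near_rising (z l : C) d n : 0 < Re z ->
  gamma_near (z + RtoC (INR n)) l d -> gamma_near z (l / rising z n) (d / Cmod (rising z n)).
Proof.
intros Hz; revert l d; induction n as [|n IH]; intros l d H.
- unfold rising; simpl Cprod; rewrite Cmod_1; simpl INR in H.
  replace (z + 0)%C with z in H by ring.
  replace (l / 1)%C with l by (field; intros E; apply RtoC_inj in E; lra).
  replace (d / 1) with d by field; auto.
- rewrite S_INR, RtoC_plus in H.
  replace (z + (RtoC (INR n) + 1))%C with (z + RtoC (INR n) + 1)%C in H by ring.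
  assert (P : 0 < Re (z + RtoC (INR n))%C) by (rewrite re_plus, re_RtoC; generalize (pos_INR n); lra).
  apply gamma_near_div in H; auto; apply IH in H.
  assert (N := Re_pos_neq_0 _ P); assert (N' := rising_neq_0 z n Hz).
  rewrite rising_S, Cmod_mult, (Cplus_comm (RtoC (INR n))).
  replace (l / (rising z n * (z + RtoC (INR n))))%C with (l / (z + RtoC (INR n)) / rising z n)%C
    by (field; auto).
  replace (d / (Cmod (rising z n) * Cmod (z + RtoC (INR n))%C)) with
    (d / Cmod (z + RtoC (INR n))%C / Cmod (rising z n)); auto.
  field; split; apply Rgt_not_eq, Cmod_gt_0; auto.
Qed.

Lemma pow_exp_ln t k : 0 < t -> t ^ k = exp (INR k * ln t).
Proof. intros H; rewrite <- ln_pow, exp_ln by (auto; apply pow_lt; auto); auto. Qed.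

Lemma is_RInt_gen_pow_exp k :
  is_RInt_gen (V := R_NormedModule) (fun t => t ^ k * exp (- t)) (at_right 0) (Rbar_locally p_infty)
    (INR (fact k)).
Proof.
assert (D0 : forall k t, is_derive (fun t => - (t ^ k * exp (- t))) t
  (t ^ k * exp (- t) - INR k * t ^ pred k * exp (- t))).
{ intros j t; auto_derive; auto; ring. }
assert (G : forall k la, filterlim (fun t => - (t ^ k * exp (- t))) (at_right 0) (locally la) ->
  filterlim (fun t => - (t ^ k * exp (- t))) (Rbar_locally p_infty) (locally 0) ->
  is_RInt_gen (V := R_NormedModule) (fun t => t ^ k * exp (- t) - INR k * t ^ pred k * exp (- t))
    (at_right 0) (Rbar_locally p_infty) (0 - la)).
{ intros j la La Lb.
  eapply is_RInt_gen_ext; [|apply (is_RInt_gen_Derive (fun t => - (t ^ j * exp (- t))) la 0); auto].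
  - apply filter_forall; intros ab t _; apply is_derive_unique, D0.
  - apply filter_forall; intros ab t _; eexists; apply D0.
  - apply filter_forall; intros ab t _.
    apply (continuous_ext (fun t => t ^ j * exp (- t) - INR j * t ^ pred j * exp (- t))).
    + intros s; symmetry; apply is_derive_unique, D0.
    + apply (ex_derive_continuous (fun t => t ^ j * exp (- t) - INR j * t ^ pred j * exp (- t))).
      auto_derive; auto. }
assert (Linf : forall k, filterlim (fun t => - (t ^ k * exp (- t))) (Rbar_locally p_infty) (locally 0)).
{ intros j; apply filterlim_locally; intros [e He].
  assert (e2 : 0 < e / 2) by lra.
  assert (X : 0 < INR (S j)) by (apply lt_0_INR; lia).
  assert (Q1 : Rbar_locally p_infty (fun t => 1 < t)) by (exists 1; auto).
  generalize (filter_and _ _ Q1 (power_exp_p_infty (INR (S j)) (e / 2) X e2)); apply filter_imp.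
  intros t [Ht1 Ht]; unfold ball; simpl; unfold AbsRing_ball, abs, minus, plus, opp; simpl.
  replace (- (t ^ j * exp (- t)) + - 0) with (- (t ^ j * exp (- t))) by ring.
  rewrite Rabs_Ropp, Rabs_pos_eq by (apply Rmult_le_pos; [apply pow_le; lra | apply Rlt_le, exp_pos]).
  apply Rle_lt_trans with (e / 2); [|lra]; apply Rle_trans with (2 := Ht).
  rewrite pow_exp_ln, <- exp_plus by lra; apply exp_le_mono; rewrite S_INR.
  assert (0 <= ln t) by (rewrite <- ln_1; apply ln_le; lra); lra. }
assert (L0 : forall k, filterlim (fun t => - (t ^ k * exp (- t))) (at_right 0) (locally (- (0 ^ k * exp (- 0))))).
{ intros j P HP; apply filter_le_within.
  refine (ex_derive_continuous (fun t => - (t ^ j * exp (- t))) 0 _ P HP).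
  eexists; apply D0. }
induction k as [|k IH].
- generalize (G O _ (L0 O) (Linf O)); simpl; rewrite Ropp_0, exp_0.
  replace (0 - - (1 * 1)) with 1 by ring.
  apply is_RInt_gen_ext; apply filter_forall; intros ab t _; Req; ring.
- assert (A := G (S k) _ (L0 (S k)) (Linf (S k))).
  rewrite pow_i in A by lia.
  assert (B := is_RInt_gen_plus (V := R_NormedModule) _ _ _ _ A
    (is_RInt_gen_scal (V := R_NormedModule) _ (INR (S k)) _ IH)).
  replace (INR (fact (S k))) with (plus (0 - - (0 * exp (- 0))) (scal (INR (S k)) (INR (fact k)))).
  + revert B; apply is_RInt_gen_ext; apply filter_forall; intros ab t _.
    unfold plus, scal; simpl pred; simpl; unfold mult; simpl; Req; ring.
  + rewrite fact_simpl, mult_INR; unfold plus, scal; simpl; unfold mult; simpl; ring.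
Qed.

Fixpoint poly_eval (p : list (R * nat)) (s : R) : R :=
  match p with
  | nil => 0
  | (c, j) :: q => c * s ^ j + poly_eval q s
  end.

(* Normalised moment of order [j] of the density [t^n exp(-t)] rescaled by [n + 1]. *)
Fixpoint moment (n j : nat) : R :=
  match j with
  | O => 1
  | S i => moment n i * (INR (n + S i) / INR (S n))
  end.

Fixpoint poly_moment (n : nat) (p : list (R * nat)) : R :=
  match p with
  | nil => 0
  | (c, j) :: q => c * moment n j + poly_moment n q
  end.

Lemma moment_fact n j : INR (fact (n + j)) / INR (S n) ^ j = INR (fact n) * moment n j.
Proof.
assert (P : 0 < INR (S n)) by (apply lt_0_INR; lia).
induction j as [|j IH].
- rewrite Nat.add_0_r; simpl; field.
- change (moment n (S j)) with (moment n j * (INR (n + S j) / INR (S n))).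
  change (INR (S n) ^ S j) with (INR (S n) * INR (S n) ^ j).
  rewrite <- Rmult_assoc, <- IH, Nat.add_succ_r, fact_simpl, mult_INR.
  field; split; [|apply pow_nonzero]; lra.
Qed.

Lemma moment_lim j : is_lim_seq (fun n => moment n j) 1.
Proof.
induction j as [|j IH]; [apply is_lim_seq_const|].
evar_last; [apply is_lim_seq_mult' with (l1 := 1) (l2 := 1 + 0); [exact IH|] | f_equal; ring].
apply is_lim_seq_ext with (fun n => 1 + INR j / INR (S n)).
- intros n; rewrite plus_INR, !S_INR; field; generalize (pos_INR n); lra.
- apply is_lim_seq_plus'; [apply is_lim_seq_const | apply is_lim_seq_inv_S].
Qed.

Lemma poly_moment_lim p : is_lim_seq (fun n => poly_moment n p) (poly_eval p 1).
Proof.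
induction p as [|[c j] p IH]; simpl; [apply is_lim_seq_const|].
apply is_lim_seq_plus'; auto.
rewrite pow1; apply is_lim_seq_mult'; [apply is_lim_seq_const | apply moment_lim].
Qed.

Lemma is_RInt_gen_poly_moment n p :
  is_RInt_gen (V := R_NormedModule) (fun t => poly_eval p (t / INR (S n)) * (t ^ n * exp (- t)))
    (at_right 0) (Rbar_locally p_infty) (INR (fact n) * poly_moment n p).
Proof.
assert (P : 0 < INR (S n)) by (apply lt_0_INR; lia).
induction p as [|[c j] p IH]; simpl poly_eval; simpl poly_moment.
- assert (A := is_RInt_gen_scal (V := R_NormedModule) _ 0 _ (is_RInt_gen_pow_exp n)).
  replace (INR (fact n) * 0) with (scal 0 (INR (fact n)))
    by (unfold scal; simpl; unfold mult; simpl; ring).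
  revert A; apply is_RInt_gen_ext; apply filter_forall; intros ab t _; reflexivity.
- assert (A := is_RInt_gen_plus (V := R_NormedModule) _ _ _ _
    (is_RInt_gen_scal (V := R_NormedModule) _ (c / INR (S n) ^ j) _ (is_RInt_gen_pow_exp (n + j))) IH).
  replace (INR (fact n) * (c * moment n j + poly_moment n p))
    with (plus (scal (c / INR (S n) ^ j) (INR (fact (n + j)))) (INR (fact n) * poly_moment n p)).
  + revert A; apply is_RInt_gen_ext; apply filter_forall; intros ab t _.
    unfold plus, scal; simpl; unfold mult; simpl.
    change (match n with O => 1 | S _ => INR n + 1 end) with (INR (S n)).
    unfold Rdiv at 3; rewrite Rpow_mult_distr, pow_inv, pow_add; unfold Rdiv; Req; ring.
  + unfold plus, scal; simpl; unfold mult; simpl.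
    change (match n with O => 1 | S _ => INR n + 1 end) with (INR (S n)).
    transitivity (c * (INR (fact (n + j)) / INR (S n) ^ j) + INR (fact n) * poly_moment n p).
    * field; apply pow_nonzero; lra.
    * rewrite moment_fact; ring.
Qed.

Lemma Rabs_ln_le s : 0 < s -> Rabs (ln s) * s <= Rabs (s - 1) * (1 + s).
Proof.
intros H; destruct (Rle_lt_dec 1 s) as [L | L].
- assert (A : 0 <= ln s) by (rewrite <- ln_1; apply ln_le; lra).
  assert (B : ln s <= s - 1).
  { generalize (exp_ineq1_le (ln s)); rewrite exp_ln by auto; lra. }
  rewrite !Rabs_pos_eq by lra; nra.
- assert (A : ln s < 0) by (rewrite <- ln_1; apply ln_increasing; lra).
  assert (B : - ln s <= / s - 1).
  { generalize (exp_ineq1_le (- ln s)); rewrite exp_Ropp, exp_ln by auto; lra. }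
  rewrite !Rabs_left by lra.
  apply Rle_trans with ((/ s - 1) * s); [apply Rmult_le_compat_r; lra|].
  rewrite Rmult_minus_distr_r, Rinv_l by lra; nra.
Qed.

(* [eps + (s - 1)^2 / eps] dominates [|s - 1|] by AM-GM and, being a polynomial, has
   explicit moments. *)
Definition concentration_poly (q : nat) (eps : R) : list (R * nat) :=
  (eps, 0%nat) :: (eps, 1%nat) :: (eps, q) :: (eps, S q) ::
  (/ eps, 3%nat) :: (- / eps, 2%nat) :: (- / eps, 1%nat) :: (/ eps, 0%nat) ::
  (/ eps, (3 + q)%nat) :: (- / eps, (2 + q)%nat) :: (- / eps, (1 + q)%nat) :: (/ eps, q) :: nil.

Lemma concentration_poly_eval q eps s :
  poly_eval (concentration_poly q eps) s =
  (eps + (s - 1) * (s - 1) / eps) * ((1 + s) * (1 + s ^ q)).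
Proof. unfold concentration_poly; simpl; unfold Rdiv; ring. Qed.

Lemma Cmod_power_minus_1 (z : C) q eps s : 0 < Re z <= INR q -> 0 < eps -> 0 < s ->
  Cmod (Cexp (z * RtoC (ln s)) - 1)%C * s <= Cmod z * poly_eval (concentration_poly q eps) s.
Proof.
intros Hq He Hs; rewrite concentration_poly_eval.
assert (sq : 0 < s ^ q) by (apply pow_lt; auto).
assert (A : Rmax 1 (exp (Re (z * RtoC (ln s))%C)) <= 1 + s ^ q).
{ apply Rmax_lub; [lra|]; rewrite re_scal_r.
  destruct (Rle_lt_dec 1 s) as [L | L].
  - rewrite (pow_exp_ln s) by auto.
    assert (exp (Re z * ln s) <= exp (INR q * ln s)); [|lra].
    apply exp_le_mono, Rmult_le_compat_r; [|lra].
    rewrite <- ln_1; apply ln_le; lra.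
  - assert (ln s < 0) by (rewrite <- ln_1; apply ln_increasing; lra).
    assert (z1 := proj1 Hq).
    assert (E : exp (Re z * ln s) <= exp 0) by (apply exp_le_mono; nra).
    rewrite exp_0 in E; lra. }
assert (B := Cmod_Cexp_minus_1 (z * RtoC (ln s))%C).
rewrite Cmod_mult, Cmod_R in B.
assert (z0 := Cmod_ge_0 z); assert (l0 := Rabs_pos (ln s)).
assert (L := Rabs_ln_le s Hs).
assert (Y : Rabs (s - 1) <= eps + (s - 1) * (s - 1) / eps).
{ assert (Y : Rabs (s - 1) * eps <= eps * eps + (s - 1) * (s - 1)).
  { rewrite <- (Rabs_pos_eq ((s - 1) * (s - 1))) by apply (Rle_0_sqr (s - 1)); rewrite Rabs_mult.
    generalize (Rabs_pos (s - 1)); nra. }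
  apply Rmult_le_reg_r with eps; auto.
  replace ((eps + (s - 1) * (s - 1) / eps) * eps) with (eps * eps + (s - 1) * (s - 1)) by (field; lra).
  auto. }
apply Rle_trans with (Cmod z * (Rabs (ln s) * s * (1 + s ^ q))).
- apply Rle_trans with (Cmod z * Rabs (ln s) * (1 + s ^ q) * s); [|right; ring].
  apply Rmult_le_compat_r; [lra|]; apply Rle_trans with (1 := B).
  apply Rmult_le_compat_l; auto; apply Rmult_le_pos; auto.
- apply Rmult_le_compat_l; auto; rewrite <- Rmult_assoc.
  apply Rmult_le_compat_r; [lra|]; apply Rle_trans with (1 := L).
  apply Rmult_le_compat_r; lra.
Qed.

Lemma gamma_near_large (z : C) q eps n : 0 < Re z <= INR q -> 0 < eps ->
  gamma_near (z + RtoC (INR (S (S n)))) (Cexp (z * RtoC (ln (INR (S n)))) * RtoC (INR (fact (S n))))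
    (Cmod (Cexp (z * RtoC (ln (INR (S n)))) * RtoC (INR (fact (S n))))%C * Cmod z *
     poly_moment n (concentration_poly q eps)).
Proof.
intros Hq He eta Heta.
set (N := INR (S n)); set (c := Cexp (z * RtoC (ln N))); set (p := concentration_poly q eps).
assert (N0 : 0 < N) by (apply lt_0_INR; lia).
set (K := Cmod c * Cmod z * N).
assert (K0 : 0 <= K) by (repeat apply Rmult_le_pos; try apply Cmod_ge_0; lra).
assert (c0 := Cmod_ge_0 c).
assert (e1 : 0 < eta / 2 / (K + 1)) by (apply Rdiv_lt_0_compat; lra).
assert (e2 : 0 < eta / 2 / (Cmod c + 1)) by (apply Rdiv_lt_0_compat; lra).
assert (A := is_RInt_gen_poly_moment n p _ (locally_ball _ (mkposreal _ e1))).
assert (B := is_RInt_gen_pow_exp (S n) _ (locally_ball _ (mkposreal _ e2))).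
unfold filtermapi in A, B.
generalize (filter_and _ _ euler_domain_pos (filter_and _ _ A B)); apply filter_imp.
intros [a b]; simpl fst; simpl snd; intros ([Ha Hb] & (v1 & I1 & B1) & v2 & I2 & B2).
change (Rabs (v1 - INR (fact n) * poly_moment n p) < eta / 2 / (K + 1)) in B1.
change (Rabs (v2 - INR (fact (S n))) < eta / 2 / (Cmod c + 1)) in B2.
change (is_RInt (fun t => poly_eval p (t / N) * (t ^ n * exp (- t))) a b v1) in I1.
change (is_RInt (fun t => t ^ S n * exp (- t)) a b v2) in I2.
set (f := gamma_integrand (z + RtoC (INR (S (S n))))).
assert (If : is_CRInt f a b (CRInt f a b)).
{ apply is_CRInt_cont; intros t Ht; rewrite Rmin_left in Ht by lra.
  apply Ccont_gamma_integrand; lra. }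
exists (CRInt f a b); split; auto.
assert (I2' : is_CRInt (fun t => c * RtoC (t ^ S n * exp (- t)))%C a b (c * RtoC v2)%C).
{ apply is_CRInt_scal, is_CRInt_RtoC; exact I2. }
assert (D : Cmod (CRInt f a b - c * RtoC v2)%C <= K * v1).
{ apply (is_CRInt_le (fun t => f t - c * RtoC (t ^ S n * exp (- t)))%C
    (fun t => K * (poly_eval p (t / N) * (t ^ n * exp (- t)))) a b); try lra.
  - intros t Ht.
    assert (t0 : 0 < t) by lra.
    assert (s0 : 0 < t / N) by (apply Rdiv_lt_0_compat; lra).
    assert (E : (f t - c * RtoC (t ^ S n * exp (- t)))%C =
      (c * (Cexp (z * RtoC (ln (t / N))) - 1) * RtoC (t ^ S n * exp (- t)))%C).
    { unfold f, gamma_integrand, c.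
      replace ((z + RtoC (INR (S (S n))) - 1) * RtoC (ln t))%C with
        (z * RtoC (ln N) + z * RtoC (ln (t / N)) + RtoC (INR (S n) * ln t))%C.
      - rewrite !Cexp_plus, Cexp_RtoC, <- pow_exp_ln, RtoC_mult by auto; ring.
      - rewrite ln_div, RtoC_minus, (S_INR (S n)), RtoC_plus, RtoC_mult by auto; ring. }
    rewrite E, !Cmod_mult, Cmod_R.
    assert (w0 : 0 < t ^ n * exp (- t)) by (apply Rmult_lt_0_compat; [apply pow_lt; auto | apply exp_pos]).
    rewrite Rabs_pos_eq by (simpl pow; rewrite Rmult_assoc; apply Rmult_le_pos; lra).
    assert (Q := Cmod_power_minus_1 z q eps (t / N) Hq He s0); fold p in Q.
    apply Rle_trans with (Cmod c * N * (t ^ n * exp (- t)) *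
      (Cmod (Cexp (z * RtoC (ln (t / N))) - 1)%C * (t / N))).
    + right; simpl pow; field; lra.
    + apply Rle_trans with (Cmod c * N * (t ^ n * exp (- t)) * (Cmod z * poly_eval p (t / N))).
      * apply Rmult_le_compat_l; auto; repeat apply Rmult_le_pos; try lra.
        apply pow_le; lra. apply Rlt_le, exp_pos.
      * right; unfold K; ring.
  - apply is_CRInt_minus; auto.
  - exact (is_RInt_scal (V := R_NormedModule) _ _ _ K _ I1). }
replace (CRInt f a b - c * RtoC (INR (fact (S n))))%C with
  ((CRInt f a b - c * RtoC v2) + c * RtoC (v2 - INR (fact (S n))))%C
  by (rewrite RtoC_minus; ring).
eapply Rle_trans; [apply Cmod_triangle|].
rewrite !Cmod_mult, !Cmod_R, (Rabs_pos_eq (INR _)) by apply pos_INR.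
apply Rabs_def2 in B1.
assert (D1 : K * v1 <= K * (INR (fact n) * poly_moment n p) + eta / 2).
{ apply Rle_trans with (K * (INR (fact n) * poly_moment n p + eta / 2 / (K + 1))).
  - apply Rmult_le_compat_l; lra.
  - rewrite Rmult_plus_distr_l; apply Rplus_le_compat_l.
    apply Rmult_le_reg_r with (K + 1); [lra|].
    replace (K * (eta / 2 / (K + 1)) * (K + 1)) with (K * (eta / 2)) by (field; lra); nra. }
assert (D2 : Cmod c * Rabs (v2 - INR (fact (S n))) <= eta / 2).
{ apply Rle_trans with (Cmod c * (eta / 2 / (Cmod c + 1))).
  - apply Rmult_le_compat_l; auto; apply Rlt_le; exact B2.
  - apply Rmult_le_reg_r with (Cmod c + 1); [lra|].
    replace (Cmod c * (eta / 2 / (Cmod c + 1)) * (Cmod c + 1)) with (Cmod c * (eta / 2)) by (field; lra); nra. }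
replace (Cmod c * INR (fact (S n)) * Cmod z * poly_moment n p) with (K * (INR (fact n) * poly_moment n p))
  by (unfold K, N; rewrite fact_simpl, mult_INR; ring).
lra.
Qed.

Lemma is_RInt_gen_gamma_integrand (z : C) : 0 < Re z ->
  is_RInt_gen (V := C_R_NormedModule) (gamma_integrand z) (at_right 0) (Rbar_locally p_infty)
    (Cexp (stirling_log z)).
Proof.
intros Hz; set (G := Cexp (stirling_log z)).
intros P [[e He] HP].
destruct (nfloor_ex (Re z)) as [q0 [_ Hq0]]; [lra|].
set (q := S q0).
assert (Hq : 0 < Re z <= INR q) by (unfold q; rewrite S_INR; lra).
set (A := fun n => (Cexp (z * RtoC (ln (INR (S n)))) * RtoC (INR (fact (S n))) / rising z (S (S n)))%C).
assert (LA : Clim A G) by exact (Euler_product_lim z Hz).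
assert (z0 := Cmod_ge_0 z); assert (G0 := Cmod_ge_0 G).
set (eps := e / 4 / (5 * ((Cmod G + 1) * Cmod z + 1))).
assert (D0 : 0 < 5 * ((Cmod G + 1) * Cmod z + 1)) by nra.
assert (e0 : 0 < eps) by (apply Rdiv_lt_0_compat; lra).
set (p := concentration_poly q eps).
assert (LP := poly_moment_lim p).
replace (poly_eval p 1) with (4 * eps) in LP
  by (unfold p; rewrite concentration_poly_eval, pow1; field; lra).
apply is_lim_seq_spec in LP; unfold is_lim_seq' in LP.
unfold Clim in LA; apply is_lim_seq_spec in LA; unfold is_lim_seq' in LA.
assert (m0 : 0 < Rmin 1 (e / 4)) by (apply Rmin_glb_lt; lra).
destruct (filter_and _ _ (LP (mkposreal _ e0)) (LA (mkposreal _ m0))) as [n Hn].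
destruct (Hn n (Nat.le_refl n)) as [Pn An]; clear Hn LP LA.
change (Rabs (poly_moment n p - 4 * eps) < eps) in Pn.
change (Rabs (Cmod (A n - G)%C - 0) < Rmin 1 (e / 4)) in An.
rewrite Rminus_0_r, Rabs_pos_eq in An by apply Cmod_ge_0.
assert (An1 := Rlt_le_trans _ _ _ An (Rmin_l _ _)).
assert (An2 := Rlt_le_trans _ _ _ An (Rmin_r _ _)).
apply Rabs_def2 in Pn.
assert (Q := gamma_near_rising z _ _ (S (S n)) Hz (gamma_near_large z q eps n Hq e0)).
assert (e4 : 0 < e / 4) by lra.
unfold filtermapi; generalize (Q _ e4); apply filter_imp; intros ab (v & Iv & Hv).
exists v; split; [exact Iv|]; apply HP.
apply C_NormedModule_mixin_compat1.
change (Cmod (v - G)%C < e).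
replace (v - G)%C with ((v - A n) + (A n - G))%C by ring.
eapply Rle_lt_trans; [apply Cmod_triangle|].
fold p in Hv.
assert (N := rising_neq_0 z (S (S n)) Hz).
assert (AG : Cmod (A n) <= Cmod G + 1).
{ replace (A n) with ((A n - G) + G)%C by ring.
  eapply Rle_trans; [apply Cmod_triangle|]; lra. }
assert (V : Cmod (v - A n)%C <= Cmod (A n) * Cmod z * poly_moment n p + e / 4).
{ eapply Rle_trans; [apply Hv|]; right; unfold A; rewrite Cmod_div by auto.
  unfold Rdiv; ring. }
assert (A0 := Cmod_ge_0 (A n)).
assert (W : Cmod (A n) * Cmod z * poly_moment n p <= e / 4).
{ apply Rle_trans with ((Cmod G + 1) * Cmod z * (5 * eps)).
  - apply Rle_trans with (Cmod (A n) * Cmod z * (5 * eps)).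
    + apply Rmult_le_compat_l; [apply Rmult_le_pos; auto | lra].
    + apply Rmult_le_compat_r; [lra|]; apply Rmult_le_compat_r; auto.
  - unfold eps; apply Rmult_le_reg_r with ((Cmod G + 1) * Cmod z + 1); [nra|].
    replace ((Cmod G + 1) * Cmod z * (5 * (e / 4 / (5 * ((Cmod G + 1) * Cmod z + 1)))) *
      ((Cmod G + 1) * Cmod z + 1)) with ((Cmod G + 1) * Cmod z * (e / 4)) by (field; nra).
    nra. }
lra.
Qed.

Lemma CGamma_stirling_log (z : C) : 0 < Re z -> CGamma z = Cexp (stirling_log z).
Proof.
intros Hz; unfold CGamma.
exact (is_RInt_gen_unique (V := C_R_CompleteNormedModule) (gamma_integrand z) _
  (is_RInt_gen_gamma_integrand z Hz)).
Qed.

(** * The branch of the logarithm of Gamma *)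

Lemma Ccont_eps_delta (f : R -> C) t :
  (forall eps, 0 < eps -> exists d, 0 < d /\
    forall s, Rabs (s - t) < d -> Cmod (f s - f t)%C < eps) -> Ccont f t.
Proof.
intros H; split; apply filterlim_locally; intros [e He]; destruct (H e He) as (d & Hd & D);
  exists (mkposreal d Hd); intros s Hs; apply Rle_lt_trans with (2 := D s Hs).
- apply (re_le_Cmod (f s - f t)%C).
- apply (Im_le_Cmod (f s - f t)%C).
Qed.

Lemma ex_derive_C_eps_delta (f : C -> C) (z : C) :
  ex_derive (K := C_AbsRing) (V := C_NormedModule) f z ->
  forall eps, 0 < eps -> exists d, 0 < d /\
    forall u, Cmod (u - z)%C < d -> Cmod (f u - f z)%C < eps.
Proof.
intros H eps He; apply ex_derive_continuous in H.
apply (filterlim_locally_ball_norm (K := C_AbsRing) (U := C_NormedModule)) with (eps := mkposreal eps He) in H.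
destruct H as [[d Hd] D]; exists d; split; auto.
Qed.

Lemma gudermann_sum_lipschitz (z z' : C) x n : 0 < x -> Re z = x -> Re z' = x ->
  Cmod (gudermann_sum z n - gudermann_sum z' n)%C <=
  / 2 * Cmod (z' - z)%C * ((1 + / x) * (/ x - / (x + INR n))).
Proof.
intros Hx Hz Hz'; unfold gudermann_sum; induction n as [|n IH].
- simpl; rewrite Rplus_0_r, Rminus_diag, !Rmult_0_r.
  replace (0 - 0)%C with (RtoC 0) by ring; rewrite Cmod_0; lra.
- rewrite !Csumlt_S.
  match goal with |- Cmod ((?A + ?B) - (?A' + ?B'))%C <= _ =>
    replace ((A + B) - (A' + B'))%C with ((A - A') + (B - B'))%C by ring end.
  eapply Rle_trans; [apply Cmod_triangle|].
  assert (n0 := pos_INR n).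
  assert (L := gudermann_lipschitz (z + RtoC (INR n)) (z' + RtoC (INR n)) (x + INR n)
    ltac:(lra) ltac:(rewrite re_plus, re_RtoC; lra) ltac:(rewrite re_plus, re_RtoC; lra)).
  replace (z' + RtoC (INR n) - (z + RtoC (INR n)))%C with (z' - z)%C in L by ring.
  assert (c0 := Cmod_ge_0 (z' - z)%C); rewrite S_INR.
  replace (/ 2 * Cmod (z' - z)%C * ((1 + / x) * (/ x - / (x + (INR n + 1))))) with
    (/ 2 * Cmod (z' - z)%C * ((1 + / x) * (/ x - / (x + INR n))) +
     / 2 * Cmod (z' - z)%C * ((1 + / x) * (/ (x + INR n) - / (x + (INR n + 1))))) by ring.
  apply Rplus_le_compat; [exact IH|]; apply Rle_trans with (1 := L).
  apply Rmult_le_compat_l; [lra|].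
  replace ((1 + / x) * (/ (x + INR n) - / (x + (INR n + 1)))) with
    (/ ((x + INR n) * (x + INR n)) * ((1 + / x) * ((x + INR n) / (x + INR n + 1)))) by (field; lra).
  assert (P : 0 < (x + INR n) * (x + INR n)) by nra.
  rewrite <- (Rmult_1_r (/ ((x + INR n) * (x + INR n)))) at 1.
  apply Rmult_le_compat_l; [apply Rlt_le, Rinv_0_lt_compat; auto|].
  replace ((1 + / x) * ((x + INR n) / (x + INR n + 1))) with (1 + INR n / (x * (x + INR n + 1))) by (field; lra).
  assert (0 <= INR n / (x * (x + INR n + 1))); [apply Rdiv_le_0_compat; nra | lra].
Qed.

Lemma mu_lipschitz (z z' : C) x : 0 < x -> Re z = x -> Re z' = x ->
  Cmod (mu z - mu z')%C <= / 2 * Cmod (z' - z)%C * ((1 + / x) * / x).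
Proof.
intros Hx Hz Hz'.
apply Clim_bound with (fun n => gudermann_sum z n - gudermann_sum z' n)%C.
- intros n; eapply Rle_trans; [apply gudermann_sum_lipschitz with (x := x); auto|].
  assert (c0 := Cmod_ge_0 (z' - z)%C); assert (i0 := Rinv_0_lt_compat x Hx).
  apply Rmult_le_compat_l; [lra|]; apply Rmult_le_compat_l; [lra|].
  assert (0 < / (x + INR n)) by (apply Rinv_0_lt_compat; generalize (pos_INR n); lra); lra.
- apply Clim_minus; apply mu_lim; lra.
Qed.

Lemma Cmod_vertical x s t : Cmod ((x, s) - (x, t))%C = Rabs (s - t).
Proof.
replace ((x, s) - (x, t))%C with (RtoC (s - t) * Ci)%C.
- rewrite Cmod_mult, Cmod_R, Cmod_Ci; ring.
- apply C_eq; simpl; ring.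
Qed.

Lemma Ccont_stirling_log_vertical x t : 0 < x -> Ccont (fun s => stirling_log (x, s)) t.
Proof.
intros Hx; unfold stirling_log.
assert (D : Cderiv (fun s => (x, s)) t Ci).
{ split; [exact (is_derive_const (V := R_NormedModule) x t) | exact (is_derive_id (K := R_AbsRing) t)]. }
assert (K := Cderiv_cont _ _ _ D).
apply Ccont_plus; [|apply Ccont_const].
apply Ccont_minus; auto; apply Ccont_plus.
- apply Ccont_eps_delta; intros eps He.
  assert (i0 := Rinv_0_lt_compat x Hx).
  set (k := / 2 * ((1 + / x) * / x)).
  assert (k0 : 0 < k) by (unfold k; nra).
  exists (eps / k); split; [apply Rdiv_lt_0_compat; auto|]; intros s Hs.
  eapply Rle_lt_trans; [apply (mu_lipschitz _ _ x); auto|].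
  rewrite Cmod_vertical, Rabs_minus_sym.
  replace (/ 2 * Rabs (s - t) * ((1 + / x) * / x)) with (Rabs (s - t) * k) by (unfold k; ring).
  apply (Rmult_lt_compat_r k) in Hs; auto.
  replace (eps / k * k) with eps in Hs by (field; lra); auto.
- apply Ccont_mult; [apply Ccont_minus; auto; apply Ccont_const|].
  exact (Cderiv_cont _ _ _ (Cderiv_Clog (fun s => (x, s)) t Ci Hx D)).
Qed.

Lemma cos_eq_1_small c : cos c = 1 -> Rabs c <= 1 -> c = 0.
Proof.
intros Hc Hb; assert (P := PI2_1).
destruct (Req_dec c 0) as [E | N]; auto; exfalso.
assert (Q : 0 < Rabs c) by (apply Rabs_pos_lt; auto).
assert (L : cos (Rabs c) < cos 0) by (apply cos_decreasing_1; lra).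
rewrite cos_0 in L; unfold Rabs in L; destruct (Rcase_abs c); rewrite ?cos_neg in L; lra.
Qed.

Lemma cos_eq_1_continuous (h : R -> R) y :
  continuity h -> (forall t, cos (h t) = 1) -> h 0 = 0 -> h y = 0.
Proof.
intros K H H0.
set (c := Rmax (- 1) (Rmin (h y) 1)).
assert (R : Rmin (h 0) (h y) <= c <= Rmax (h 0) (h y)).
{ unfold c; rewrite H0; unfold Rmax, Rmin; destruct (Rle_dec (h y) 1);
  repeat match goal with |- context [Rle_dec ?a ?b] => destruct (Rle_dec a b) end; lra. }
destruct (IVT_gen h 0 y c K R) as [s [_ Hs]].
assert (c0 : c = 0).
{ apply cos_eq_1_small; [rewrite <- Hs; apply H|].
  apply Rabs_le; unfold c; split; [apply Rmax_l|].
  apply Rmax_lub; [lra | apply Rmin_r]. }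
revert c0; unfold c, Rmax, Rmin; destruct (Rle_dec (h y) 1);
repeat match goal with |- context [Rle_dec ?a ?b] => destruct (Rle_dec a b) end; lra.
Qed.

Lemma Cexp_eq (u v : C) : Cexp u = Cexp v -> Re u = Re v /\ cos (Im u - Im v) = 1.
Proof.
intros H.
assert (E : Re u = Re v) by (apply exp_inv; rewrite <- !Cmod_Cexp, H; reflexivity).
split; auto.
assert (D : Cexp (u - v)%C = 1%C).
{ unfold Cminus; rewrite Cexp_plus, Cexp_opp, H; apply Cinv_r, Cexp_neq_0. }
apply (f_equal Re) in D; unfold Cexp in D; simpl in D.
fold (Re u) (Re v) (Im u) (Im v) in D.
rewrite E, Rplus_opp_r, exp_0, Rmult_1_l in D; exact D.
Qed.

(* The two logarithms of Gamma differ on the vertical line through [z] by a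
   continuous multiple of [2 i PI], which vanishes on the real axis. *)
Lemma logGamma_stirling_log (L : C -> C) (z : C) :
  is_logGamma L -> 0 < Re z -> L z = stirling_log z.
Proof.
intros (D & E & RL) Hz; set (x := Re z) in *.
assert (A : forall t, Re (L (x, t)) = Re (stirling_log (x, t)) /\
  cos (Im (L (x, t)) - Im (stirling_log (x, t))) = 1).
{ intros t; apply Cexp_eq; rewrite E by auto; apply CGamma_stirling_log; auto. }
destruct z as [x' y]; change x with x' in *; clear x; simpl in Hz.
apply C_eq; [apply A|].
apply Rminus_diag_uniq.
apply (cos_eq_1_continuous (fun t => Im (L (x', t)) - Im (stirling_log (x', t)))).
- intros t; apply continuity_pt_filterlim.
  apply (continuous_minus (fun t => Im (L (x', t))) (fun t => Im (stirling_log (x', t)))).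
  + apply (Ccont_eps_delta (fun t => L (x', t))); intros eps He.
    destruct (ex_derive_C_eps_delta L (x', t) (D (x', t) Hz) eps He) as (d & Hd & HD).
    exists d; split; auto; intros s Hs; apply HD; rewrite Cmod_vertical; auto.
  + apply (Ccont_stirling_log_vertical x' t Hz).
- intros t; apply A.
- change (x', 0) with (RtoC x'); rewrite RL, stirling_log_RtoC by auto; simpl; ring.
Qed.

Theorem theorem3 :
  (forall logGamma : C -> C, is_logGamma logGamma ->
   forall z alpha : C, 0 < Re z -> - Re z < Re alpha ->
     is_series (K := C_AbsRing) (V := C_NormedModule)
       (fun n : nat =>
          binet_poly (S n) alpha
            / Cprod (fun k => z + alpha + RtoC (INR k)) (S n))%C
       (Binet logGamma z)) /\
  (forall (m : nat) (alpha : C), (1 <= m)%nat ->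
     binet_poly m alpha =
     (binet_num m +
      alpha *
      Csum (fun k =>
        RtoC (Binomial.C (m - 1) (k - 1)) *
        Cprod (fun j => alpha + RtoC (INR (j + 1))) (m - k - 1) *
        binet_num k) 1 (m - 1))%C) /\
  (forall (m : nat) (alpha : C), (1 <= m)%nat ->
     binet_poly m alpha =
     (1 / RtoC (INR m) *
      Csegment_int (fun x =>
        (x + 1 / 2 - alpha) * Cprod (fun k => RtoC (INR k) + x) m)
        (alpha - 1) alpha)%C) /\
  (forall alpha : C, binet_poly 1 alpha = (1 / 12)%C) /\
  (forall alpha : C, binet_poly 2 alpha = (alpha / 12)%C).
Proof.
split; [|split; [exact binet_poly_binet_num | split; [exact binet_poly_segment_int |
  split; [exact binet_poly_1 | exact binet_poly_2]]]].
intros L HL z alpha Hz Ha.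
destruct (ex_gudermann_series z alpha Hz Ha) as (F & HF & HG).
replace (Binet L z) with F.
- apply is_series_Clim; apply Clim_ext with (2 := HF).
  intros n; apply Csumlt_ext; intros k _; unfold binet_term, rising.
  rewrite (Cprod_ext (fun j => RtoC (INR j) + (z + alpha))%C (fun j => z + alpha + RtoC (INR j))%C)
    by (intros; ring).
  reflexivity.
- rewrite (Clim_unique _ _ _ HG (mu_lim z Hz)).
  unfold Binet; rewrite (logGamma_stirling_log L z HL Hz); unfold stirling_log; ring.
Qed.
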